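(* Let $z_1,\dots,z_n$ be distinct points in the open unit disk $\mathbf D$, let $w_1,\dots,w_n$ be any complex numbers, and let $\kappa$ be a nonnegative integer. Set $$P=\left[\frac{1-w_j\bar w_k}{1-z_j\bar z_k}\right]_{j,k=1}^n.$$ (1) If $P$ has $\kappa$ negative eigenvalues, then there is a pair $(f,B)$ with $f\in\mathbf S_0$ and $B$ a Blaschke product of degree $\kappa$ such that $f(z_j)=B(z_j)w_j$ for all $j=1,\dots,n$. (2) If there is a pair $(f,B)$ with $f\in\mathbf S_0$ and $B$ a Blaschke product of degree $\kappa$ such that $f(z_j)=B(z_j)w_j$ for all $j=1,\dots,n$, then $P$ has $\kappa'\le\kappa$ negative eigenvalues.
   Context: $\mathbf S_0$ is the Schur class: holomorphic functions on $\mathbf D$ bounded by one in modulus. A Blaschke product of degree $\kappa$ is a function $B(z)=\gamma\prod_{j=1}^\kappa \frac{z-a_j}{1-z\bar a_j}$ with $|\gamma|=1$ and $a_1,\dots,a_\kappa\in\mathbf D$ not necessarily distinct (for $\kappa=0$, a constant of modulus one). Negative eigenvalues are counted with multiplicity. *)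

(* Defs.v *)
From HB Require Import structures.
From mathcomp Require Import all_boot all_order all_algebra.
From mathcomp Require Import complex.
From mathcomp Require Import all_classical all_reals all_analysis.

Set Implicit Arguments.
Unset Strict Implicit.
Unset Printing Implicit Defensive.

Import Order.TTheory GRing.Theory Num.Theory.
Import numFieldNormedType.Exports.

Local Open Scope classical_set_scope.
Local Open Scope ring_scope.

(* Functions on the disk are represented by total functions R[i] -> R[i] whose
   values off [unit_disk R] are irrelevant: no predicate below constrains them.
   The norm and the order are those of R[i], so [`|z| < 1] compares reals and
   [x < 0] says that x is real and negative. *)
Definition unit_disk (R : realType) : set R[i] := [set z | `|z| < 1].

Arguments unit_disk R : clear implicits.

(* [derivable _ z 1] is over the field R[i], i.e., complex differentiability:
   the difference quotient has a limit as the increment tends to 0 in R[i]. *)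
Definition holomorphic_on (R : realType) (D : set R[i]) (f : R[i] -> R[i]) :
    Prop :=
  forall z, D z -> derivable (f : R[i]^o -> R[i]^o) z 1.

Definition schur_class (R : realType) : set (R[i] -> R[i]) :=
  [set f | holomorphic_on (unit_disk R) f /\
           forall z, unit_disk R z -> `|f z| <= 1].

Arguments schur_class R : clear implicits.

Definition blaschke_product (R : realType) (k : nat) (B : R[i] -> R[i]) :
    Prop :=
  exists (g : R[i]) (a : 'I_k -> R[i]),
    [/\ `|g| = 1,
        forall j, unit_disk R (a j) &
        forall z, unit_disk R z ->
          B z = g * \prod_(j < k) ((z - a j) / (1 - z * (a j)^* ))].

(* The roots of the characteristic polynomial, repeated according to
   multiplicity. *)
Definition eigenvalues (R : realType) (n : nat) (A : 'M[R[i]]_n) : seq R[i] :=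
  sval (closed_field_poly_normal (char_poly A)).

Definition num_neg_eigenvalues (R : realType) (n : nat) (A : 'M[R[i]]_n) :
    nat :=
  count (fun x : R[i] => x < 0) (eigenvalues A).

Definition pick_matrix (R : realType) (n : nat) (z w : 'I_n -> R[i]) :
    'M[R[i]]_n :=
  \matrix_(j < n, k < n) ((1 - w j * (w k)^* ) / (1 - z j * (z k)^* )).

(* Main.v *)
(* A function [f] interpolates [B w] with [f] Schur exactly when the Pick matrix
   of the data [B w] is positive semidefinite; this is the case without negative
   squares.  Its necessity half is the reproducing property of the Szego kernel
   on circles [|zeta| = r < 1], its sufficiency half the Schur algorithm.

   (2) With [D = diag (B z_j)], [D P D^*] is the Pick matrix of [f], which is
   positive, minus that of [B], which has rank at most [kappa]; hence [P] is
   nonnegative on the image under [D] of a subspace of codimension [kappa], and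
   [D] is injective there because the Szego matrix is positive definite.

   (1) After replacing [w] by [t w] with [t < 1] close to 1, [P] is invertible.
   Replacing [w] by [b_a w], with [b_a] a Blaschke factor, amounts to adding to
   [P] the rank one matrix [(1 - |a|^2) c_a c_a^*], [c_a = (1 / (z_j - a))_j],
   which removes a negative square as soon as
   [1 + (1 - |a|^2) c_a^* P^-1 c_a <= 0].  If this happens for no [a] in the
   disk, then the left-hand side, viewed as a kernel in [a], factors through a
   Schur function and is therefore positive; letting [a] approach the nodes
   gives [P^-1 >= 0].  So [kappa] Blaschke factors make the Pick matrix positive,
   and a compactness argument lets [t] tend to 1; zeros that escape to the unit
   circle turn into constants. *)

Require Import Defs.
From mathcomp Require Import all_boot all_order all_algebra.
From mathcomp Require Import complex.
From mathcomp Require Import all_classical all_reals all_analysis.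
From mathcomp Require Import ring lra zify.

Set Implicit Arguments.
Unset Strict Implicit.
Unset Printing Implicit Defensive.

Import Order.TTheory GRing.Theory Num.Theory.
Import numFieldNormedType.Exports.

Local Open Scope classical_set_scope.
Local Open Scope ring_scope.
Local Open Scope sesquilinear_scope.

(** * Quadratic forms and negative squares *)

Section QuadraticForms.
Variable C : numClosedFieldType.

(** Eigenvalues enter only at the two ends. In between, negative squares are counted by
    [nonneg_codim A k], which is monotone in [k], invariant under invertible congruence and stable
    under adding a positive matrix. Part (1) thus starts from at most [kappa] negative squares but
    must produce exactly [kappa] zeros, so surplus zeros have to be absorbed without loss of
    positivity. The Schur function that appears when no Blaschke factor helps is the quotient of the
    two entries of a transfer function attached to the Stein equation of [P]. It is rational, and
    its possible singularities are removed by dividing numerator and denominator by their gcd. A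
    Schur function comes without boundary values, so the Hardy space argument runs on circles of
    radius [r < 1]. Cauchy's formula there is proved by Goursat's bisection in polar coordinates
    centred at the evaluation point [a]: the form [dz / (z - a)] becomes [ds/s + dlog dt], and a
    single parameter rectangle covers the disk up to a shrinking neighbourhood of [a]. *)

Definition qform n (A : 'M[C]_n) (x : 'rV[C]_n) : C := (x *m A *m x^t* ) 0 0.

(** Vectors are rows and subspaces are row spaces, so the rows of [U] span a subspace of codimension
    at most [k]. *)
Definition nonneg_codim n (A : 'M[C]_n) (k : nat) : Prop :=
  exists (m : nat) (U : 'M[C]_(m, n)), (n <= \rank U + k)%N /\
    forall x, (x <= U)%MS -> 0 <= qform A x.

Lemma qformE n (A : 'M[C]_n) x :
  qform A x = \sum_i \sum_j x 0 i * (x 0 j)^* * A i j.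
Proof.
rewrite /qform mxE exchange_big /=; apply: eq_bigr => j _.
rewrite !mxE mulr_suml; apply: eq_bigr => i _.
by rewrite mulrAC.
Qed.

Lemma qform_conj m n (A : 'M[C]_n) (B : 'M[C]_(m, n)) x :
  qform (B *m A *m B^t* ) x = qform A (x *m B).
Proof. by rewrite /qform trmx_mul map_mxM !mulmxA. Qed.

Lemma qformD n (A B : 'M[C]_n) x : qform (A + B) x = qform A x + qform B x.
Proof. by rewrite /qform mulmxDr mulmxDl mxE. Qed.

Lemma qformB n (A B : 'M[C]_n) x : qform (A - B) x = qform A x - qform B x.
Proof. by rewrite /qform mulmxBr mulmxBl !mxE. Qed.

Lemma qformZ n (A : 'M[C]_n) c x : qform (c *: A) x = c * qform A x.
Proof. by rewrite /qform -scalemxAr -scalemxAl mxE. Qed.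

Lemma qform_gram m n (B : 'M[C]_(n, m)) x :
  qform (B *m B^t* ) x = \sum_i `|(x *m B) 0 i| ^+ 2.
Proof.
rewrite /qform mulmxA -mulmxA -map_mxM -trmx_mul mxE; apply: eq_bigr => i _.
by rewrite !mxE normCK.
Qed.

Lemma qform_diag n (d : 'rV[C]_n) x :
  qform (diag_mx d) x = \sum_i d 0 i * `|x 0 i| ^+ 2.
Proof.
rewrite /qform mxE; apply: eq_bigr => i _.
by rewrite mul_mx_diag !mxE normCK mulrCA mulrA.
Qed.

Lemma char_poly_conj n (P A : 'M[C]_n) : P \in unitmx ->
  char_poly (invmx P *m A *m P) = char_poly A.
Proof.
move=> uP; rewrite /char_poly /char_poly_mx.
have uPX : map_mx polyC P \in unitmx by rewrite map_unitmx.
have -> : 'X%:M - map_mx polyC (invmx P *m A *m P) =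
    invmx (map_mx polyC P) *m ('X%:M - map_mx polyC A) *m map_mx polyC P.
  rewrite mulmxBr mulmxBl scalar_mxC mulmxKV //.
  by rewrite !map_mxM map_invmx.
by rewrite !det_mulmx det_inv mulrAC mulVr ?mul1r // -unitmxE.
Qed.

(** Coordinate embedding. When the rows of [P] are eigenvectors and [p] is a sign condition on the
    eigenvalues, [selmx p *m P] spans the eigenvectors of that sign. *)
Definition selmx n (p : pred 'I_n) : 'M[C]_(#|p|, n) :=
  \matrix_(i, j) (enum_val i == j)%:R.

Lemma selmx_diag n (p : pred 'I_n) (d : 'rV[C]_n) :
  selmx p *m diag_mx d *m (selmx p)^t* = diag_mx (\row_i d 0 (enum_val i)).
Proof.
apply/matrixP => i j; rewrite mxE (bigD1 (enum_val i)) //= big1 ?addr0.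
  rewrite mul_mx_diag !mxE eqxx mul1r (inj_eq enum_val_inj).
  by rewrite eq_sym; case: eqP; rewrite ?rmorph1 ?rmorph0 ?mulr1 ?mulr0.
move=> l lN; rewrite mul_mx_diag !mxE eq_sym (negbTE lN).
by rewrite mul0r mul0r.
Qed.

Lemma row_free_selmx n (p : pred 'I_n) : row_free (selmx p).
Proof.
apply/row_freeP; exists ((selmx p)^t* ).
have := selmx_diag p (const_mx 1); rewrite diag_const_mx mulmx1 => ->.
by apply/matrixP => i j; rewrite !mxE.
Qed.

(** In a spectral basis, a subspace on which the form is nonnegative meets the span of the negative
    eigenvectors only in 0, which bounds the dimension of that span. Conversely the remaining
    eigenvectors span a subspace of the required codimension. *)
Lemma hermitian_count n (A : 'M[C]_n) (s : seq C) k : A = A^t* ->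
  char_poly A = \prod_(x <- s) ('X - x%:P) ->
  nonneg_codim A k <-> (count (fun x : C => (x < 0)%R) s <= k)%N.
Proof.
move=> hA sA; have /orthomx_spectralP : A \is normalmx.
  by apply/normalmxP; rewrite -hA.
set P := spectralmx A; set d := spectral_diag A => defA.
have uP : P \in unitmx by apply: spectral_unit.
have PV : invmx P = P^t* by apply: invmx_unitary (spectral_unitarymx A).
have dR i : d 0 i \is Num.real.
  have /mxOverP -> // : d \is a realmx.
  by apply: hermitian_spectral_diag_real; apply/is_hermitianmxP; rewrite expr0 scale1r.
have ->: count (fun x : C => (x < 0)%R) s = #|[pred i | d 0 i < 0]|.
  have /permP -> : perm_eq s [seq d 0 i | i : 'I_n].
    apply: prod_XsubC_eq; rewrite -sA defA char_poly_conj //.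
    rewrite char_poly_trig; last by apply: diag_mx_is_trig.
    by rewrite big_image /=; apply: eq_bigr => i _; rewrite mxE eqxx.
  by rewrite count_map cardE size_filter enumT; apply: eq_count => i ;rewrite inE.
have qP (p : pred 'I_n) y : qform A (y *m (selmx p *m P)) =
    \sum_i d 0 (enum_val i) * `|y 0 i| ^+ 2.
  have -> : A = P^t* *m diag_mx d *m P^t*^t* by rewrite trmxCK -PV.
  rewrite qform_conj mulmxA mulmxtVK; last exact: spectral_unitarymx.
  rewrite -[LHS]qform_conj selmx_diag qform_diag.
  by apply: eq_bigr => i _; rewrite mxE.
have rkP p : \rank (selmx p *m P) = #|p|.
  by rewrite mxrankMfree ?row_free_unit //; apply/eqP/row_free_selmx.
split=> [[m [U [rU pU]]]|le_k].
  pose W := selmx [pred i | d 0 i < 0] *m P.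
  have UW0 : (U :&: W)%MS = 0.
    apply/eqP; rewrite -submx0; apply/row_subP => i.
    have := row_sub i (U :&: W)%MS; rewrite sub_capmx => /andP[/pU + /submxP[y xE]].
    rewrite xE /W qP => ge0; suff -> : y = 0 by rewrite mul0mx sub0mx.
    apply/rowP => j; rewrite mxE; apply/eqP; apply: contraLR ge0 => yj.
    rewrite lt_geF // -oppr_gt0 -sumrN (bigD1 j) //= ltr_pwDl //.
      rewrite -mulNr mulr_gt0 ?exprn_gt0 ?normr_gt0 // oppr_gt0.
      exact: (enum_valP j).
    apply: sumr_ge0 => l _; rewrite -mulNr mulr_ge0 ?exprn_ge0 // oppr_ge0.
    exact/ltW/(enum_valP l).
  have := rank_leq_col (U + W)%MS; rewrite (mxrank_disjoint_sum UW0) rkP.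
  by move=> /leq_trans /(_ rU); rewrite leq_add2l.
exists _, (selmx [pred i | 0 <= d 0 i] *m P); split=> [|x /submxP[y ->]].
  rewrite rkP; apply: leq_trans (leq_add (leqnn _) le_k).
  rewrite -{1}(card_ord n) -(cardC [pred i | 0 <= d 0 i]) leq_add2l.
  apply/eq_leq/eq_card => i; rewrite !inE real_leNgt ?negbK //; exact: dR.
rewrite qP; apply: sumr_ge0 => l _; rewrite mulr_ge0 ?exprn_ge0 //.
exact: (enum_valP l).
Qed.
End QuadraticForms.

(** * Pick matrices *)

Section PickMatrices.
Variable C : numClosedFieldType.

Definition pickmx n (z w : 'I_n -> C) : 'M[C]_n :=
  \matrix_(j, k) ((1 - w j * (w k)^* ) / (1 - z j * (z k)^* )).

Definition bfactor (a z : C) : C := (z - a) / (1 - z * a^* ).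

Lemma subr1_conjM_neq0 (a b : C) : `|a| < 1 -> `|b| <= 1 -> 1 - a * b^* != 0.
Proof.
move=> a1 b1; rewrite subr_eq0; apply/eqP => /(congr1 Num.norm).
rewrite normr1 normrM norm_conjC => E.
have : `|a| * `|b| <= `|a| by rewrite ler_piMr.
by rewrite -E => /le_lt_trans/(_ a1); rewrite ltxx.
Qed.

Lemma pickmx_herm n (z w : 'I_n -> C) : pickmx z w = (pickmx z w)^t*.
Proof.
apply/matrixP => i j; rewrite !mxE rmorphM fmorphV !rmorphB !rmorphM rmorph1 /= !conjCK.
by rewrite (mulrC (w j)^*) (mulrC (z j)^*).
Qed.

Lemma qform0 n (A : 'M[C]_n) : qform A 0 = 0.
Proof. by rewrite /qform !mul0mx mxE. Qed.

Lemma qform_real n (A : 'M[C]_n) x : A = A^t* -> qform A x \is Num.real.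
Proof.
move=> hA; rewrite CrealE /qform; apply/eqP.
have -> (B : 'M[C]_1) : (B 0 0)^* = (B^t* ) 0 0 by rewrite !mxE.
by rewrite !trmx_mul !map_mxM trmxCK -hA mulmxA.
Qed.

Lemma schur_complement n (A : 'M[C]_n.+1) x : A = A^t* -> A 0 0 != 0 ->
  qform A x = `|\sum_j x 0 j * A j 0| ^+ 2 / A 0 0 +
    \sum_(i < n) \sum_(j < n) x 0 (lift 0 i) * (x 0 (lift 0 j))^* *
       (A (lift 0 i) (lift 0 j) - A (lift 0 i) 0 * A 0 (lift 0 j) / A 0 0).
Proof.
move=> hA A00.
have hA' i j : (A i j)^* = A j i by rewrite {2}hA !mxE.
have -> : `|\sum_j x 0 j * A j 0| ^+ 2 =
    (\sum_j x 0 j * A j 0) * (\sum_i (x 0 i)^* * A 0 i).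
  rewrite normCK rmorph_sum; congr (_ * _); apply: eq_bigr => i _.
  by rewrite rmorphM /= hA'.
rewrite qformE.
have -> : (\sum_j x 0 j * A j 0) * (\sum_i (x 0 i)^* * A 0 i) / A 0 0 =
   \sum_i \sum_j x 0 i * (x 0 j)^* * (A i 0 * A 0 j / A 0 0).
  rewrite -mulrA mulr_suml; apply: eq_bigr => i _.
  rewrite mulr_suml mulr_sumr; apply: eq_bigr => j _; ring.
apply/eqP; rewrite addrC -subr_eq -sumrB; apply/eqP.
under eq_bigr do rewrite -sumrB.
rewrite big_ord_recl big1 ?add0r => [|j _]; last first.
  by rewrite -mulrBr (mulrC (A 0 0)) mulfK // subrr mulr0.
apply: eq_bigr => i _; rewrite big_ord_recl -mulrBr mulfK // subrr mulr0 add0r.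
by apply: eq_bigr => j _; rewrite -mulrBr.
Qed.

(** One step of the Schur algorithm in matrix form: up to a diagonal congruence and the factor
    [1 - |w 0|^2], the Schur complement at node 0 is the Pick matrix of the data obtained by moving
    [w 0] to 0 with a disk automorphism and dividing by the Blaschke factor at [z 0]. *)
Lemma pickmx_schur n (z w : 'I_n.+1 -> C) x :
    (forall j, `|z j| < 1) -> (forall j, z (lift 0 j) != z 0) ->
    `|w 0| != 1 -> (forall j, 1 - (w 0)^* * w (lift 0 j) != 0) ->
  qform (pickmx z w) x = `|\sum_j x 0 j * pickmx z w j 0| ^+ 2 / pickmx z w 0 0 +
    qform (pickmx (fun j => z (lift 0 j))
       (fun j => (w (lift 0 j) - w 0) / (1 - (w 0)^* * w (lift 0 j)) /
          bfactor (z 0) (z (lift 0 j))))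
      (\row_j (x 0 (lift 0 j) * (bfactor (z 0) (z (lift 0 j)) * (1 - (w 0)^* * w (lift 0 j)))))
     / (1 - `|w 0| ^+ 2).
Proof.
move=> z1 zN w0 wN.
have w02 : 1 - w 0 * (w 0)^* != 0 by rewrite -normCK subr_eq0 eq_sym sqrp_eq1.
rewrite schur_complement; [|exact: pickmx_herm|]; last first.
  by rewrite mxE mulf_neq0 // invr_neq0 // subr1_conjM_neq0 // ltW.
congr (_ + _); rewrite qformE mulr_suml; apply: eq_bigr => i _.
rewrite mulr_suml; apply: eq_bigr => j _.
have := subr1_conjM_neq0 (z1 (lift 0 i)) (ltW (z1 (lift 0 j))).
have := subr1_conjM_neq0 (z1 (lift 0 i)) (ltW (z1 0)).
have := subr1_conjM_neq0 (z1 0) (ltW (z1 (lift 0 j))).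
have := subr1_conjM_neq0 (z1 0) (ltW (z1 0)).
have := wN i; have : (1 - w 0 * (w (lift 0 j))^* != 0).
  by have := wN j; rewrite -conjC_eq0 rmorphB rmorphM /= conjCK rmorph1.
have : z (lift 0 i) - z 0 != 0 by rewrite subr_eq0.
have : (z (lift 0 j))^* - (z 0)^* != 0 by rewrite -rmorphB conjC_eq0 subr_eq0.
rewrite normCK /bfactor !mxE !(rmorphM, rmorphB, rmorph1, fmorphV) /= !conjCK.
move: w02 {z1 zN w0 wN}.
move: (z 0) (z (lift 0 i)) ((z (lift 0 j))^* ) ((z 0)^* ) => z0 zi zj z0c.
move: (w 0) (w (lift 0 i)) ((w (lift 0 j))^* ) ((w 0)^* ) => w0 wi wj w0c.
move: (x 0 (lift 0 i)) ((x 0 (lift 0 j))^* ) => xi xj *.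
by field; do ?[apply/andP; split]; rewrite // mulrC //.
Qed.

Lemma pickmx00_gt0 n (z w : 'I_n.+1 -> C) : `|z 0| < 1 -> `|w 0| < 1 ->
  0 < pickmx z w 0 0.
Proof. by move=> z1 w1; rewrite mxE -!normCK divr_gt0 // subr_gt0 exprn_ilt1. Qed.

Lemma bfactor_neq0 (a z : C) : `|a| < 1 -> `|z| < 1 -> z != a -> bfactor a z != 0.
Proof.
by move=> a1 z1 za; rewrite mulf_neq0 ?invr_neq0 ?subr_eq0 // -subr_eq0 subr1_conjM_neq0 // ltW.
Qed.

(* The Szego matrix is the Pick matrix of the zero data. *)
Lemma szego_gt0 n (z : 'I_n -> C) (x : 'rV[C]_n) : injective z ->
  (forall j, `|z j| < 1) -> x != 0 -> 0 < qform (pickmx z (fun=> 0)) x.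
Proof.
elim: n z x => [|n IHn] z x zI z1; first by rewrite thinmx0 eqxx.
move=> x0; have zN j : z (lift 0 j) != z 0 by rewrite (inj_eq zI) eq_sym neq_lift.
have P00 : 0 < pickmx z (fun=> 0) 0 0 by rewrite pickmx00_gt0 // normr0.
have w0 : `|0 : C| != 1 by rewrite normr0 eq_sym oner_eq0.
rewrite (pickmx_schur _ z1 zN w0) => [|j]; last by rewrite mulr0 subr0 oner_eq0.
rewrite normr0 expr0n /= !subr0 divr1.
set w' := (X in _ + qform (pickmx _ X) _); set x' := (X in _ + qform _ X).
(* The Schur step sends zero data to zero data, so the induction stays within Szego matrices. *)
have -> : pickmx (fun j => z (lift 0 j)) w' = pickmx (fun j => z (lift 0 j)) (fun=> 0).
  by apply/matrixP => i j; rewrite !mxE /w' !mul0r.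
have [x'0|x'N0] := eqVneq x' 0.
  rewrite x'0 qform0 addr0 divr_gt0 // exprn_gt0 // normr_gt0.
  have xl j : x 0 (lift 0 j) = 0.
    have /rowP/(_ j) := x'0; rewrite !mxE conjC0 mul0r subr0 mulr1 => /eqP.
    by rewrite mulf_eq0 (negPf (bfactor_neq0 _ _ _)) // orbF => /eqP.
  rewrite big_ord_recl big1 => [|j _]; last by rewrite xl mul0r.
  rewrite addr0 mulf_neq0 ?(lt0r_neq0 P00) //; apply: contra x0 => /eqP x00.
  by apply/eqP/rowP => j; rewrite mxE; case: (unliftP 0 j) => [k ->|->].
rewrite ltr_wpDl ?IHn //.
- by rewrite divr_ge0 ?exprn_ge0 // ltW.
- by move=> i j /zI/lift_inj.
Qed.

Lemma szego_unit n (z : 'I_n -> C) : injective z -> (forall j, `|z j| < 1) ->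
  pickmx z (fun=> 0) \in unitmx.
Proof.
move=> zI z1; rewrite -row_free_unit -kermx_eq0; apply/eqP/row_matrixP => i.
rewrite row0; apply/eqP; apply: contraT => /(szego_gt0 zI z1).
by rewrite /qform (sub_kermxP (row_sub _ _)) mul0mx mxE ltxx.
Qed.

Definition szcol n (z : 'I_n -> C) a : 'cV[C]_n := \col_j (1 - z j * a^* )^-1.

Lemma pickmx_bfactor n (z w : 'I_n -> C) a : (forall j, `|z j| < 1) -> `|a| <= 1 ->
  pickmx z (fun j => bfactor a (z j) * w j) =
  (1 - `|a| ^+ 2) *: (szcol z a *m (szcol z a)^t* ) +
  diag_mx (\row_j bfactor a (z j)) *m pickmx z w *m (diag_mx (\row_j bfactor a (z j)))^t*.
Proof.
move=> z1 a1; apply/matrixP => i j.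
rewrite tr_diag_mx map_diag_mx mul_mx_diag mul_diag_mx !mxE big_ord1 !mxE.
have := subr1_conjM_neq0 (z1 i) (ltW (z1 j)).
have := subr1_conjM_neq0 (z1 i) a1.
have : 1 - a * (z j)^* != 0.
  by have := subr1_conjM_neq0 (z1 j) a1; rewrite -conjC_eq0 rmorphB rmorphM /= conjCK rmorph1 mulrC.
rewrite normCK /bfactor !(rmorphM, rmorphB, rmorph1, fmorphV) /= !conjCK => *.
by field; do ?[apply/andP; split]; rewrite // mulrC.
Qed.

Lemma qform_rank1 n (c : 'cV[C]_n) x : qform (c *m c^t* ) x = `|(x *m c) 0 0| ^+ 2.
Proof. by rewrite qform_gram big_ord1. Qed.

Lemma qform_pickmx_bfactor n (z w : 'I_n -> C) a x : (forall j, `|z j| < 1) -> `|a| <= 1 ->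
  qform (pickmx z (fun j => bfactor a (z j) * w j)) x =
  (1 - `|a| ^+ 2) * `|(x *m szcol z a) 0 0| ^+ 2 +
  qform (pickmx z w) (x *m diag_mx (\row_j bfactor a (z j))).
Proof. by move=> z1 a1; rewrite pickmx_bfactor // qformD qformZ qform_rank1 qform_conj. Qed.

(** The [k] columns of [V] express the rank bound: each factor contributes the rank one term of
    [pickmx_bfactor], and the Pick matrix of a unimodular constant is zero. *)
Lemma blaschke_kernel n k (z : 'I_n -> C) (a : 'I_k -> C) g :
    (forall j, `|z j| < 1) -> (forall i, `|a i| <= 1) -> `|g| = 1 ->
  exists V : 'M[C]_(n, k), forall x, x *m V = 0 ->
    qform (pickmx z (fun j => g * \prod_(i < k) bfactor (a i) (z j))) x = 0.
Proof.
move=> z1; elim: k a => [|k IHk] a a1 g1.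
  exists 0 => x _; rewrite (_ : pickmx _ _ = 0) ?/qform ?mulmx0 ?mul0mx ?mxE //.
  by apply/matrixP => i j; rewrite !mxE !big_ord0 !mulr1 -normCK g1 expr1n subrr mul0r.
have [V VP] := IHk (fun i => a (lift 0 i)) (fun i => a1 _) g1.
pose D := diag_mx (\row_j bfactor (a 0) (z j)).
exists (row_mx (szcol z (a 0)) (D *m V)) => x x0.
have : row_mx (x *m szcol z (a 0)) (x *m (D *m V)) = row_mx 0 0.
  by rewrite -mul_mx_row row_mx0.
move=> /eq_row_mx[xg]; rewrite mulmxA => /VP xV.
rewrite (_ : pickmx _ _ = pickmx z (fun j => bfactor (a 0) (z j) *
  (g * \prod_(i < k) bfactor (a (lift 0 i)) (z j)))).
  by rewrite qform_pickmx_bfactor // xg xV mxE normr0 expr0n mulr0 addr0.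
by apply/matrixP => i j; rewrite !mxE !big_ord_recl !(mulrCA g).
Qed.

Lemma nonneg_codim_of_interpolation n k (z w f B : 'I_n -> C) :
    injective z -> (forall j, `|z j| < 1) ->
    (forall j, f j = B j * w j) -> (forall x, 0 <= qform (pickmx z f) x) ->
    (exists V : 'M[C]_(n, k), forall x, x *m V = 0 -> qform (pickmx z B) x = 0) ->
  nonneg_codim (pickmx z w) k.
Proof.
move=> zI z1 fB f0 [V VP].
pose D := diag_mx (\row_j B j).
have PE : D *m pickmx z w *m D^t* = pickmx z f - pickmx z B.
  apply/matrixP => i j.
  rewrite tr_diag_mx map_diag_mx mul_mx_diag mul_diag_mx !mxE !fB rmorphM /=; ring.
have SE : pickmx z B = pickmx z (fun=> 0) - D *m pickmx z (fun=> 0) *m D^t*.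
  apply/matrixP => i j.
  rewrite tr_diag_mx map_diag_mx mul_mx_diag mul_diag_mx !mxE; ring.
exists n, (kermx V *m D); split; last first.
  move=> x /submxP[y ->]; rewrite mulmxA -qform_conj PE qformB VP ?subr0 //.
  by rewrite -mulmxA mulmx_ker mulmx0.
(* If [x] is annihilated by both [V] and [D], then [SE] makes its Szego form vanish, so [x = 0];
   multiplication by [D] therefore keeps the rank of [kermx V]. *)
have /mxrank_injP -> : (kermx V :&: kermx D)%MS == 0.
  apply/eqP/row_matrixP => i; rewrite row0.
  have := row_sub i (kermx V :&: kermx D)%MS; rewrite sub_capmx.
  move=> /andP[/sub_kermxP xV /sub_kermxP xD].
  have := VP _ xV; rewrite SE qformB qform_conj xD qform0 subr0.
  by move=> q0; apply/eqP; apply: contraT => /(szego_gt0 zI z1); rewrite q0 ltxx.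
rewrite mxrank_ker; have := rank_leq_col V; lia.
Qed.

End PickMatrices.

(** * Removing one negative square *)

Section Reduction.
Variable C : numClosedFieldType.

Lemma nonneg_codim_conj n (D A : 'M[C]_n) k : D \in unitmx ->
  nonneg_codim A k -> nonneg_codim (D *m A *m D^t* ) k.
Proof.
move=> uD [m [U [rU U0]]]; exists m, (U *m invmx D); split.
  by rewrite mxrankMfree // row_free_unit unitmx_inv.
move=> x /submxP[y ->]; rewrite qform_conj mulmxA mulmxKV //.
by apply: U0; apply: submxMl.
Qed.

Lemma nonneg_codim_psd n (A : 'M[C]_n) k : (forall x, 0 <= qform A x) -> nonneg_codim A k.
Proof. by move=> A0; exists n, 1%:M; rewrite mxrank1 leq_addr. Qed.

Lemma qform_conjugate n (A : 'M[C]_n) x : A = A^t* -> (qform A x)^* = qform A x.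
Proof. by move=> hA; apply/CrealP/qform_real. Qed.

(** The direction gained is [y = c^* A^-1]. The value [q] of the form of [A] at [y] is negative by
    the last hypothesis, so [y] lies outside the subspace [U], and the perturbed form stays
    nonnegative on the sum of [U] and the line of [y]. *)
Lemma nonneg_codim_rank1 n (A : 'M[C]_n) (c : 'cV[C]_n) (rho : C) k : A = A^t* ->
    A \in unitmx -> 0 <= rho -> nonneg_codim A k.+1 ->
    1 + rho * (c^t* *m invmx A *m c) 0 0 <= 0 ->
  nonneg_codim (A + rho *: (c *m c^t* )) k.
Proof.
move=> hA uA rho0 [m [U [rU U0]]].
pose y := c^t* *m invmx A; set q := (y *m c) 0 0 => q0.
have yA : y *m A = c^t* by rewrite mulmxKV.
have Ay : A *m y^t* = c.
  have := congr1 (fun M : 'rV_n => M^t* ) yA; rewrite trmxCK trmx_mul map_mxM /= => <-.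
  by congr (_ *m _).
have qE : qform A y = q by rewrite /qform -mulmxA Ay.
have q_lt0 : q < 0.
  have qR : q \is Num.real by rewrite -qE qform_real.
  rewrite real_ltNge ?real0 //; apply: contraL q0 => q_ge0.
  by rewrite lt_geF // (lt_le_trans ltr01) // lerDl mulr_ge0.
exists (m + 1)%N, (col_mx U y); split.
  have Uy : (U :&: y)%MS = 0.
    apply/row_matrixP => i; rewrite row0.
    have := row_sub i (U :&: y)%MS; rewrite sub_capmx => /andP[/U0 + /sub_rVP[a xE]].
    rewrite xE => H; have : qform A (a *: y) = `|a| ^+ 2 * q.
      rewrite /qform linearZ /= map_mxZ -scalemxAl -scalemxAr -scalemxAl scalerA mxE.
      by rewrite normCK (mulrC a^*) -/(qform A y) qE.
    move=> E; rewrite E in H; have a0 : a = 0; last by rewrite a0 scale0r.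
    apply/eqP; apply: contraLR H => a0; rewrite lt_geF //.
    by rewrite nmulr_llt0 // exprn_gt0 // normr_gt0.
  rewrite -addsmxE mxrank_disjoint_sum // rank_rV.
  have -> : y != 0 by apply: contraTneq q_lt0 => y0; rewrite /q y0 mul0mx mxE ltxx.
  by rewrite -addnA add1n.
move=> x; rewrite -addsmxE => /sub_addsmxP[[v l] ->] /=.
set v' := v *m U; have v0 : 0 <= qform A v' by rewrite U0 // submxMl.
clearbody v'.
have [t ->] : exists t, l *m y = t *: y by exists (l 0 0); rewrite {1}[l]mx11_scalar mul_scalar_mx.
pose s := (v' *m c) 0 0.
(* Completing the square in [t]. All three terms are nonnegative because [q < 0] and
   [1 + rho * q <= 0]. *)
have E : qform (A + rho *: (c *m c^t* )) (v' + t *: y) =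
   qform A v' - `|s| ^+ 2 / q + `|t + s / q| ^+ 2 * (q * (1 + rho * q)).
  rewrite qformD qformZ qform_rank1 mulmxDl -scalemxAl.
  have -> : (v' *m c + t *: (y *m c)) 0 0 = s + t * q by rewrite mxE [X in _ + X]mxE.
  have -> : qform A (v' + t *: y) = qform A v' + t^* * s + t * s^* + t * t^* * q.
    rewrite /qform; have -> : (v' + t *: y)^t* = v'^t* + t^* *: y^t*.
      by apply/matrixP => i j; rewrite !mxE rmorphD rmorphM.
    have cv : (c^t* *m v'^t* ) 0 0 = s^*.
      have -> : c^t* *m v'^t* = (v' *m c)^t* by rewrite trmx_mul map_mxM.
      by rewrite mxE mxE.
    have vy : (v' *m A *m y^t* ) 0 0 = s by rewrite -mulmxA Ay.
    have yy : (c^t* *m y^t* ) 0 0 = q by rewrite -qE /qform yA.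
    rewrite mulmxDr !mulmxDl -!scalemxAl -!scalemxAr yA.
    have mD (M N : 'M[C]_1) : (M + N) 0 0 = M 0 0 + N 0 0 by rewrite mxE.
    have mZ a (M : 'M[C]_1) : (a *: M) 0 0 = a * M 0 0 by rewrite mxE.
    rewrite !(mD, mZ) cv vy yy; ring.
  have qc : q^* = q by rewrite -qE qform_conjugate.
  rewrite !normCK !(rmorphD, rmorphM, fmorphV) /= qc; field.
  by rewrite lt_eqF.
rewrite E addr_ge0 //.
  rewrite addr_ge0 // -mulrN -invrN mulr_ge0 ?exprn_ge0 // invr_ge0 oppr_ge0 ltW //.
by rewrite mulr_ge0 ?exprn_ge0 // mulr_le0 // ltW.
Qed.

Definition cauchycol n (z : 'I_n -> C) a : 'cV[C]_n := \col_j (z j - a)^-1.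

(** With [D] the diagonal matrix of the values of the Blaschke factor,
    [D *m cauchycol z a = szcol z a], so [pickmx_bfactor] exhibits the new Pick matrix as congruent
    to a rank one perturbation of the old one. As [a] is not a node, [D] is invertible. *)
Lemma pickmx_reduce n (z w : 'I_n -> C) a k : (forall j, `|z j| < 1) ->
    `|a| < 1 -> (forall j, z j != a) -> pickmx z w \in unitmx ->
    nonneg_codim (pickmx z w) k.+1 ->
    1 + (1 - `|a| ^+ 2) *
      ((cauchycol z a)^t* *m invmx (pickmx z w) *m cauchycol z a) 0 0 <= 0 ->
  nonneg_codim (pickmx z (fun j => bfactor a (z j) * w j)) k.
Proof.
move=> z1 a1 za uP hk h.
have rho0 : 0 <= 1 - `|a| ^+ 2 by rewrite subr_ge0 exprn_ile1 // ltW.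
have := nonneg_codim_rank1 (pickmx_herm z w) uP rho0 hk h.
set D := diag_mx (\row_j bfactor a (z j)).
have uD : D \in unitmx.
  rewrite unitmxE det_diag unitfE; apply/prodf_neq0 => j _.
  by rewrite mxE bfactor_neq0.
move=> /(nonneg_codim_conj uD); rewrite pickmx_bfactor // ?ltW // -/D.
have <- : D *m cauchycol z a = szcol z a.
  apply/colP => j; rewrite mul_diag_mx !mxE.
  by rewrite /bfactor mulrAC divff ?mul1r // subr_eq0.
by rewrite trmx_mul map_mxM mulmxDr mulmxDl -scalemxAr -scalemxAl !mulmxA addrC.
Qed.

(* The kernel identity behind the lossless transfer function of the Stein
   equation [P - Z P Z^* = e e^* - w w^*], normalised at the boundary point 1. *)
Lemma transfer_identity n (z w : 'I_n -> C) (a b : C) :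
    (forall j, `|z j| < 1) -> (forall j, z j != a) -> (forall j, z j != b) ->
    pickmx z w \in unitmx ->
  let X := invmx (pickmx z w) in
  let psi1 b := 1 + (1 - b) * ((cauchycol z 1)^t* *m X *m cauchycol z b) 0 0 in
  let psi2 b :=
    (1 - b) * ((\col_j (w j / (z j - 1)))^t* *m X *m cauchycol z b) 0 0 in
  (psi1 a)^* * psi1 b - (psi2 a)^* * psi2 b =
  1 + (1 - a^* * b) * ((cauchycol z a)^t* *m X *m cauchycol z b) 0 0.
Proof.
move=> z1 za zb uP X psi1 psi2.
have zN j : z j - 1 != 0.
  by rewrite subr_eq0; apply: contraTneq (z1 j) => ->; rewrite normr1 ltxx.
pose ew : 'cV[C]_n := \col_j (w j / (z j - 1)); pose e := cauchycol z 1.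
pose P := pickmx z w.
have hX : X^t* = X by rewrite /X trmx_inv map_invmx -pickmx_herm.
pose Y := diag_mx (\row_j (z j - 1)^-1).
(* The Stein equation multiplied by the inverse of [Z - 1] on the left and by its adjoint on the
   right becomes a Lyapunov equation. *)
have stein : e *m e^t* - ew *m ew^t* = - (Y *m P + P *m Y^t* + P).
  apply/matrixP => i j; rewrite tr_diag_mx map_diag_mx mul_mx_diag mul_diag_mx !mxE !big_ord1 !mxE.
  have := subr1_conjM_neq0 (z1 i) (ltW (z1 j)).
  have := zN i; have : (z j)^* - 1 != 0 by rewrite -conjC_eq0 rmorphB /= conjCK rmorph1.
  rewrite !(rmorphM, rmorphB, rmorph1, fmorphV) /= => *.
  by field; do ?[apply/andP; split].
(* Resolvent identity of [diag(z_j)] between the points 1 and [c]. *)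
have eE (c : C) : (forall j, z j != c) -> e = cauchycol z c + (1 - c) *: (Y *m cauchycol z c).
  move=> zc; apply/colP => j; rewrite mul_diag_mx !mxE.
  have := zN j; have : z j - c != 0 by rewrite subr_eq0.
  by move=> *; field; apply/andP; split.
set ca := cauchycol z a; set cb := cauchycol z b.
have mD (M N : 'M[C]_1) : (M + N) 0 0 = M 0 0 + N 0 0 by rewrite mxE.
have mN (M : 'M[C]_1) : (- M) 0 0 = - M 0 0 by rewrite mxE.
have mZ d (M : 'M[C]_1) : (d *: M) 0 0 = d * M 0 0 by rewrite mxE.
have mM (M N : 'M[C]_1) : (M *m N) 0 0 = M 0 0 * N 0 0 by rewrite mxE big_ord1.
have conjE (u v : 'cV[C]_n) : ((u^t* *m X *m v) 0 0)^* = (v^t* *m X *m u) 0 0.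
  have -> : v^t* *m X *m u = (u^t* *m X *m v)^t* by rewrite !trmx_mul !map_mxM trmxCK hX mulmxA.
  by rewrite [RHS]mxE [in RHS]mxE.
pose x := (ca^t* *m X *m cb) 0 0.
pose p := (ca^t* *m X *m Y *m cb) 0 0.
pose r := (ca^t* *m Y^t* *m X *m cb) 0 0.
have E1 : (ca^t* *m X *m e) 0 0 = x + (1 - b) * p.
  by rewrite (eE b zb) mulmxDr -scalemxAr mD mZ mulmxA.
have E2 : (e^t* *m X *m cb) 0 0 = x + (1 - a^* ) * r.
  rewrite (eE a za).
  have -> : (cauchycol z a + (1 - a) *: (Y *m cauchycol z a))^t* =
      ca^t* + (1 - a^* ) *: (ca^t* *m Y^t* ).
    rewrite -map_mxM -trmx_mul -/ca; move: (Y *m ca) => v; apply/matrixP => i j.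
    by rewrite !mxE !(rmorphD, rmorphM, rmorphN, rmorph1) /=.
  by rewrite !mulmxDl -!scalemxAl mD mZ.
have E3 : (ca^t* *m X *m e) 0 0 * (e^t* *m X *m cb) 0 0 -
          (ca^t* *m X *m ew) 0 0 * (ew^t* *m X *m cb) 0 0 = - (p + r + x).
  transitivity ((ca^t* *m X *m (e *m e^t* - ew *m ew^t* ) *m X *m cb) 0 0).
    by rewrite mulmxBr !mulmxBl mD mN -!mM !mulmxA.
  rewrite stein mulmxN !mulNmx mN !mulmxDr !mulmxDl !mD !mulmxA.
  by rewrite /X mulmxK // !mulmxKV.
rewrite /psi1 /psi2 -/e -/ew rmorphD rmorph1 !rmorphM rmorphB rmorph1 /= !conjE -/ca -/cb.
rewrite -/x.
transitivity (1 + (1 - b) * (e^t* *m X *m cb) 0 0 + (1 - a^* ) * (ca^t* *m X *m e) 0 0 +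
   (1 - a^* ) * (1 - b) * ((ca^t* *m X *m e) 0 0 * (e^t* *m X *m cb) 0 0 -
          (ca^t* *m X *m ew) 0 0 * (ew^t* *m X *m cb) 0 0)); first ring.
rewrite E3 E1 E2; ring.
Qed.

(** A nonzero polynomial has fewer than [size p] roots, while [d/2, d/3, ...] supplies [size p]
    distinct candidates; starting at [d/2] keeps them strictly below [d]. *)
Lemma exists_small_nonroot (p : {poly C}) (d : C) : p != 0 -> 0 < d ->
  exists2 c, 0 < c < d & p.[c] != 0.
Proof.
move=> p0 d0; pose rs := [seq d / i.+2%:R | i <- iota 0 (size p)].
have urs : uniq rs.
  rewrite map_inj_uniq ?iota_uniq // => i j.
  move=> /(mulfI (lt0r_neq0 d0))/invr_inj/eqP.
  by rewrite eqr_nat => /eqP[].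
have : ~~ all (root p) rs.
  apply/negP => /(max_poly_roots p0)/(_ urs).
  by rewrite size_map size_iota ltnn.
move=> /allPn[c /mapP[i _ ->] pc]; exists (d / i.+2%:R) => //.
by rewrite divr_gt0 ?ltr0n //= gtr_pMr // invf_lt1 ?ltr0n // ltr1n.
Qed.

(** For [t^2 = 1 / (1 + c)] the Pick matrix of [t w] is [t^2 (P + c S)], with [S] the positive
    definite Szego matrix. Adding [c S] preserves nonnegativity on any subspace, and [P + c S] is
    singular only when [c] is a root of the characteristic polynomial of [- S^-1 P]. *)
Lemma pickmx_perturb n (z w : 'I_n -> C) (d : C) : injective z ->
    (forall j, `|z j| < 1) -> 0 < d ->
  exists t : C, [/\ 0 < t, 1 - d < t <= 1, pickmx z (fun j => t * w j) \in unitmx &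
    forall k, nonneg_codim (pickmx z w) k ->
      nonneg_codim (pickmx z (fun j => t * w j)) k].
Proof.
move=> zI z1 d0.
set P := pickmx z w; set S := pickmx z (fun=> 0).
have uS : S \in unitmx by apply: szego_unit.
have [c /andP[c0 cd]] : exists2 c, 0 < c < d & (char_poly (- (invmx S *m P))).[c] != 0.
  by apply: exists_small_nonroot => //; apply/monic_neq0/char_poly_monic.
have -> : (char_poly (- (invmx S *m P))).[c] = \det (c%:M + invmx S *m P).
  rewrite /char_poly -horner_evalE -det_map_mx; congr (\det _).
  apply/matrixP => i j; rewrite !mxE /= /horner_eval hornerD hornerN hornerC.
  by rewrite hornerMn hornerX opprK.
move=> detN; have uPS : P + c *: S \in unitmx.
  have -> : P + c *: S = S *m (c%:M + invmx S *m P).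
    by rewrite mulmxDr mulKVmx // mul_mx_scalar addrC.
  by rewrite unitmx_mul uS unitmxE unitfE.
have c1 : 0 < 1 + c by rewrite addr_gt0.
pose t := (sqrtC (1 + c))^-1.
have t0 : 0 < t by rewrite invr_gt0 sqrtC_gt0.
have tt : t * t = (1 + c)^-1 by rewrite -expr2 exprVn sqrtCK.
have t1 : t <= 1.
  rewrite invf_le1 ?sqrtC_gt0 // -{1}(@sqrtC1 C).
  by rewrite ler_sqrtC ?qualifE /= ?ler01 ?(ltW c1) // lerDl ltW.
have PE : pickmx z (fun j => t * w j) = (1 + c)^-1 *: (P + c *: S).
  apply/matrixP => i j; rewrite !mxE -tt rmorphM /= (geC0_conj (ltW t0)).
  have tc : t * t * (1 + c) = 1 by rewrite tt mulVf // lt0r_neq0.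
  rewrite conjC0 mulr0 subr0 -{1}tc; ring.
exists t; split=> //.
- rewrite t1 andbT; apply: lt_le_trans (_ : t * t <= _); last by rewrite ler_piMr // ltW.
  rewrite tt -subr_gt0.
  have -> : (1 + c)^-1 - (1 - d) = (d - c + d * c) / (1 + c) by field; rewrite lt0r_neq0.
  by rewrite divr_gt0 // addr_gt0 ?mulr_gt0 // subr_gt0.
- by rewrite PE unitmxZ // unitfE invr_neq0 // lt0r_neq0.
move=> k [m [U [rU U0]]]; exists m, U; split=> // x xU.
rewrite PE qformZ qformD qformZ mulr_ge0 ?invr_ge0 ?(ltW c1) //.
rewrite addr_ge0 ?U0 // mulr_ge0 ?(ltW c0) //.
have [->|x0] := eqVneq x 0; first by rewrite qform0.
by rewrite ltW // szego_gt0.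
Qed.

End Reduction.

(** * Integrals of complex functions of a real variable *)

Section ComplexCalculus.
Variable R : realType.
Local Notation C := R[i].
Local Notation ReC := (@complex.Re R).
Local Notation ImC := (@complex.Im R).

Definition cts (h : R -> C) (x : R) : Prop := {for x, continuous (h : R -> C^o)}.

Lemma cts_cst (c : C) x : cts (fun=> c) x.
Proof. exact: cst_continuous. Qed.

Lemma ctsM f g x : cts f x -> cts g x -> cts (fun t => f t * g t) x.
Proof. exact: continuousM. Qed.

Lemma ctsD f g x : cts f x -> cts g x -> cts (fun t => f t + g t) x.
Proof. exact: continuousD. Qed.

Lemma ctsB f g x : cts f x -> cts g x -> cts (fun t => f t - g t) x.
Proof. exact: continuousB. Qed.

Lemma ctsV f x : cts f x -> f x != 0 -> cts (fun t => (f t)^-1) x.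
Proof. move=> cf f0; exact: (@continuousV C _ (f : R -> C^o) x f0 cf). Qed.

Lemma cts_comp (f : C -> C) g x : cts g x ->
  {for g x, continuous (f : C^o -> C^o)} -> cts (f \o g) x.
Proof.
move=> cg cf; exact: (@continuous_comp R C^o C^o g f x cg cf).
Qed.

Lemma normc_ge_Im (z : C) : `|ImC z|%:C%C <= `|z|.
Proof. by rewrite normc_def lecR -sqrtr_sqr ler_wsqrtr // lerDr sqr_ge0. Qed.

Lemma norm_real_complex (x : R) : `|x%:C%C| = `|x|%:C%C.
Proof. by rewrite normc_def /= expr0n addr0 sqrtr_sqr. Qed.

Lemma norm_imaginary : `|'i%C : C| = 1.
Proof. by rewrite normc_def /= expr0n add0r expr1n sqrtr1. Qed.

Lemma continuous_Re (x : C) : {for x, continuous (ReC : C^o -> R)}.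
Proof.
apply/(@cvgrPdist_lt _ _ _ (nbhs (x : C^o)) (nbhs_filter _)) => e e0.
have : \forall t \near (x : C^o), `|(x : C^o) - t| < e%:C%C.
  by apply: (@nbhsx_ballx C C^o x); rewrite ltcR.
apply: filterS => t h.
by rewrite -raddfB /= -ltcR; apply: le_lt_trans (normc_ge_Re _) h.
Qed.

Lemma continuous_Im (x : C) : {for x, continuous (ImC : C^o -> R)}.
Proof.
apply/(@cvgrPdist_lt _ _ _ (nbhs (x : C^o)) (nbhs_filter _)) => e e0.
have : \forall t \near (x : C^o), `|(x : C^o) - t| < e%:C%C.
  by apply: (@nbhsx_ballx C C^o x); rewrite ltcR.
apply: filterS => t h.
by rewrite -raddfB /= -ltcR; apply: le_lt_trans (normc_ge_Im _) h.
Qed.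

Lemma normc_le_ReIm (z : C) : `|z| <= (`|ReC z| + `|ImC z|)%:C%C.
Proof.
rewrite {1}[z]complexE raddfD /=; apply: le_trans (ler_normD _ _) _.
by rewrite normrM norm_imaginary mul1r !norm_real_complex.
Qed.

Lemma cts_complex (f g : R -> R) x : {for x, continuous f} -> {for x, continuous g} ->
  cts (fun t => (f t +i* g t)%C) x.
Proof.
move=> cf cg; apply/(@cvgrPdist_lt C C^o _ (nbhs x) (nbhs_filter _)) => e e0.
have [e1 eE] : exists e1 : R, e = e1%:C%C.
  by exists (ReC e); rewrite RRe_real // gtr0_real.
rewrite eE ltcR in e0 *.
have e2 : 0 < e1 / 2 by rewrite divr_gt0.
have hf := (cvgrPdist_lt (f : R -> R^o) (f x)).1 cf _ e2.
have hg := (cvgrPdist_lt (g : R -> R^o) (g x)).1 cg _ e2.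
near=> t; apply: le_lt_trans (normc_le_ReIm _) _.
by rewrite ltcR /= [e1]splitr ltrD //; near: t; [exact: hf|exact: hg].
Unshelve. all: by end_near.
Qed.

Lemma derivable_continuous (f : C^o -> C^o) z : derivable f z 1 -> {for z, continuous f}.
Proof. by move/derivable1_diffP; exact: differentiable_continuous. Qed.

(** First-order approximation in the form used by the local Goursat estimate. The condition [0 < e]
    in [C] already forces [e] to be real. *)
Lemma derivable_eps (f : C^o -> C^o) (z : C) : derivable f z 1 ->
  exists d : C, forall e : C, 0 < e -> exists2 dl : C, 0 < dl &
  forall y : C, `|y - z| < dl -> `|f y - f z - d * (y - z)| <= e * `|y - z|.
Proof.
move=> /cvg_ex[/= d df]; exists d => e e0.
move: df => /cvgr_dist_lt/(_ _ e0).
rewrite /dnbhs /= /within /= => /nbhs_ballP[dl /= dl0 hdl].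
exists dl => // y yz; have [->|yN] := eqVneq y z; first by rewrite !subrr mulr0 subrr normr0 mulr0.
have y0 : y - z != 0 by rewrite subr_eq0.
have := hdl (y - z).
rewrite /ball /= sub0r normrN => /(_ yz y0).
have -> : (y - z)%:A = y - z :> C^o by rewrite /GRing.scale /= mulr1.
rewrite subrK => h.
have -> : f y - f z - d * (y - z) = - ((d - (y - z)^-1 * (f y - f z)) * (y - z)).
  by rewrite mulrBl opprB (mulrAC _ (f y - f z)) mulVf // mul1r.
by rewrite normrN normrM ler_wpM2r // ltW.
Qed.

(* Componentwise integral; the two components are bounded separately below, so
   the norm estimate [cint_le] carries a harmless factor 2. *)
Definition cint (a b : R) (h : R -> C) : C :=
  ((\int[lebesgue_measure]_(x in `[a, b]) ReC (h x)) +i*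
   (\int[lebesgue_measure]_(x in `[a, b]) ImC (h x)))%C.

Definition cts_on (a b : R) (h : R -> C) := forall x, a <= x <= b -> cts h x.

Lemma cts_Re h x : cts h x -> {for x, continuous (fun t => ReC (h t))}.
Proof. move=> ch; exact: (@continuous_comp R C^o R h _ x ch (@continuous_Re (h x))). Qed.

Lemma cts_Im h x : cts h x -> {for x, continuous (fun t => ImC (h t))}.
Proof. move=> ch; exact: (@continuous_comp R C^o R h _ x ch (@continuous_Im (h x))). Qed.

Lemma continuous_integrable a b (f : R -> R) :
  (forall x, a <= x <= b -> {for x, continuous f}) ->
  lebesgue_measure.-integrable `[a, b] (EFin \o f).
Proof.
move=> cf; apply: continuous_compact_integrable; first exact: segment_compact.
apply: continuous_in_subspaceT => x; rewrite inE /= in_itv /=; exact: cf.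
Qed.

Lemma integrable_Re a b h : cts_on a b h ->
  lebesgue_measure.-integrable `[a, b] (EFin \o (fun t => ReC (h t))).
Proof. by move=> ch; apply: continuous_integrable => x /ch/cts_Re. Qed.

Lemma integrable_Im a b h : cts_on a b h ->
  lebesgue_measure.-integrable `[a, b] (EFin \o (fun t => ImC (h t))).
Proof. by move=> ch; apply: continuous_integrable => x /ch/cts_Im. Qed.

Lemma eq_cint a b f g : (forall x, a <= x <= b -> f x = g x) -> cint a b f = cint a b g.
Proof.
move=> fg; rewrite /cint; congr Complex; apply: eq_Rintegral => x;
  by rewrite inE /= in_itv /= => /fg ->.
Qed.

Lemma cintD a b f g : cts_on a b f -> cts_on a b g ->
  cint a b (fun x => f x + g x) = cint a b f + cint a b g.
Proof.
move=> cf cg; rewrite /cint.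
under eq_Rintegral do rewrite raddfD.
under [X in (_ +i* X)%C]eq_Rintegral do rewrite raddfD.
by rewrite !RintegralD //; do ?[exact: integrable_Re | exact: integrable_Im].
Qed.

Lemma cintZ a b (c : C) f : cts_on a b f ->
  cint a b (fun x => c * f x) = c * cint a b f.
Proof.
move=> cf; rewrite /cint; case: c => c d /=.
have iR := integrable_Re cf; have iI := integrable_Im cf.
have reE x : ReC ((c +i* d)%C * f x) = c * ReC (f x) - d * ImC (f x) by case: (f x).
have imE x : ImC ((c +i* d)%C * f x) = c * ImC (f x) + d * ReC (f x) by case: (f x).
under eq_Rintegral do rewrite reE.
under [X in (_ +i* X)%C]eq_Rintegral do rewrite imE.
have iZ (k : R) (g : R -> R) : lebesgue_measure.-integrable `[a, b] (EFin \o g) ->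
    lebesgue_measure.-integrable `[a, b] (EFin \o (fun x => k * g x)).
  by move=> ig; apply: (@integrableZl _ _ _ lebesgue_measure _ _ k (EFin \o g)).
by rewrite RintegralB ?RintegralD ?RintegralZl //; apply: iZ.
Qed.

Lemma cintB a b f g : cts_on a b f -> cts_on a b g ->
  cint a b (fun x => f x - g x) = cint a b f - cint a b g.
Proof.
move=> cf cg; transitivity (cint a b (fun x => f x + -1 * g x)).
  by apply: eq_cint => x _; rewrite mulN1r.
have cg' : cts_on a b (fun x => -1 * g x).
  by move=> x xab; apply: ctsM; [exact: cts_cst|exact: cg].
by rewrite (cintD cf cg') (cintZ _ cg) mulN1r.
Qed.

Lemma cint_conj a b f : cts_on a b f ->
  cint a b (fun x => (f x)^* ) = (cint a b f)^*.
Proof.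
move=> cf; have imE x : ImC (f x)^* = -1 * ImC (f x) by rewrite mulN1r; case: (f x).
have reE x : ReC (f x)^* = ReC (f x) by case: (f x).
rewrite /cint; under eq_Rintegral do rewrite reE.
under [X in (_ +i* X)%C]eq_Rintegral do rewrite imE.
by rewrite RintegralZl ?mulN1r //; exact: integrable_Im.
Qed.

Lemma cint_itv a c b f : a <= c -> c <= b -> cts_on a b f ->
  cint a b f = cint a c f + cint c b f.
Proof.
move=> ac cb cf.
have sp (g : R -> R) : lebesgue_measure.-integrable `[a, b] (EFin \o g) ->
    \int[lebesgue_measure]_(x in `[a, b]) g x =
    \int[lebesgue_measure]_(x in `[a, c]) g x + \int[lebesgue_measure]_(x in `[c, b]) g x.
  move=> ig; apply/eqP; rewrite addrC -subr_eq; apply/eqP.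
  rewrite Rintegral_itvB ?bnd_simp //.
  rewrite Rintegral_itv_obnd_cbnd //; apply: integrableS ig => //.
  by apply: subset_itvr; rewrite bnd_simp.
by rewrite /cint !sp //; [exact: integrable_Im|exact: integrable_Re].
Qed.

Lemma Rintegral_itv_cst a b (c : R) : a <= b ->
  \int[lebesgue_measure]_(x in `[a, b]) c = c * (b - a).
Proof.
move=> ab; rewrite Rintegral_cst //= lebesgue_measure_itv /= lte_fin.
by case: ltgtP ab => //= ->; rewrite subrr.
Qed.

Lemma cint_cst a b (c : C) : a <= b -> cint a b (fun=> c) = c * (b - a)%:C%C.
Proof.
move=> ab; rewrite /cint !Rintegral_itv_cst //.
by case: c => c d /=; simpc.
Qed.

Lemma Rintegral_itv_le a b (M : R) (f : R -> R) : a <= b ->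
  lebesgue_measure.-integrable `[a, b] (EFin \o f) ->
  (forall x, a <= x <= b -> `|f x| <= M) ->
  `|\int[lebesgue_measure]_(x in `[a, b]) f x| <= M * (b - a).
Proof.
move=> ab fi fM; apply: le_trans (le_normr_Rintegral _ fi) _ => //.
rewrite -Rintegral_itv_cst //; apply: le_Rintegral => //.
- exact: integrable_norm.
- by apply: continuous_integrable => x _; exact: cst_continuous.
Qed.

Lemma cint_le a b (M : R) f : a <= b -> cts_on a b f ->
  (forall x, a <= x <= b -> `|f x| <= M%:C%C) ->
  `|cint a b f| <= (2 * M * (b - a))%:C%C.
Proof.
move=> ab cf fM; apply: le_trans (normc_le_ReIm _) _.
have -> : 2 * M * (b - a) = M * (b - a) + M * (b - a) by ring.
rewrite lecR lerD //=.
  apply: Rintegral_itv_le => //; first exact: integrable_Re.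
  by move=> x /fM; rewrite -lecR; apply: le_trans (normc_ge_Re _).
apply: Rintegral_itv_le => //; first exact: integrable_Im.
by move=> x /fM; rewrite -lecR; apply: le_trans (normc_ge_Im _).
Qed.

Lemma cint_ge0 a b f : (forall x, a <= x <= b -> 0 <= f x) -> 0 <= cint a b f.
Proof.
move=> f0; rewrite /cint.
have E x : x \in `[a, b]%classic -> ImC (f x) = 0.
  by rewrite inE /= in_itv /= => /f0; rewrite lecE /= => /andP[/eqP].
have -> : \int[lebesgue_measure]_(x in `[a, b]) ImC (f x) = 0.
  transitivity (\int[lebesgue_measure]_(x in `[a, b]) (0 : R)); first exact: eq_Rintegral.
  by rewrite Rintegral_cst // mul0r.
rewrite lecE /= eqxx /=; apply: Rintegral_ge0 => x /=.
by rewrite in_itv /= => /f0; rewrite lecE /= => /andP[].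
Qed.

Lemma Rintegral_ftc (a b : R) (F f : R -> R) : a <= b ->
  (forall x, a <= x <= b -> {for x, continuous f}) ->
  (forall x : R, is_derive x 1 F (f x)) ->
  \int[lebesgue_measure]_(x in `[a, b]) f x = F b - F a.
Proof.
rewrite le_eqVlt => /predU1P[<-|ab] cf dF.
  by rewrite set_itv1 Rintegral_set1 subrr.
have cF x : {for x, continuous F}.
  by apply/differentiable_continuous/derivable1_diffP; case: (dF x).
rewrite /Rintegral (continuous_FTC2 ab (F := F)) //.
- apply: continuous_in_subspaceT => x; rewrite inE /= in_itv /=; exact: cf.
- split.
  + by move=> x _; case: (dF x).
  + by apply: cvg_at_right_filter; exact: cF.
  + by apply: cvg_at_left_filter; exact: cF.
- by move=> x _; rewrite derive1E; case: (dF x).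
Qed.

Lemma cint_ftc (a b : R) (F f : R -> C) : a <= b -> cts_on a b f ->
  (forall x : R, is_derive x 1 (fun t => ReC (F t)) (ReC (f x))) ->
  (forall x : R, is_derive x 1 (fun t => ImC (F t)) (ImC (f x))) ->
  cint a b f = F b - F a.
Proof.
move=> ab cf dR dI; rewrite /cint.
rewrite (Rintegral_ftc ab _ dR) => [|x /cf/cts_Re //].
rewrite (Rintegral_ftc ab _ dI) => [|x /cf/cts_Im //].
by case: (F b) (F a) => ? ? [? ?].
Qed.

End ComplexCalculus.

(** * Cauchy's formula on a circle *)

Section Bisection.
Variable R : realType.

Lemma exists_halfpow_lt (e : R) : 0 < e -> exists n : nat, 2^-1 ^+ n < e.
Proof.
move=> e0; exists (Num.bound e^-1).
rewrite exprVn invf_plt ?posrE ?exprn_gt0 //.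
apply: lt_le_trans (archi_boundP _) _; first by rewrite invr_ge0 ltW.
by rewrite -natrX ler_nat ltnW // ltn_expl.
Qed.

Lemma nested_intervals (x : nat -> R) :
  (forall n, x n <= x n.+1 <= x n + 2^-1 ^+ n.+1) ->
  exists p, forall n, x n <= p <= x n + 2^-1 ^+ n.
Proof.
move=> xS; have half n : 2^-1 ^+ n = 2^-1 ^+ n.+1 + 2^-1 ^+ n.+1 :> R by rewrite exprS; lra.
have homo m n : (m <= n)%N -> x m <= x n.
  by apply: (@homo_leq _ x <=%R lexx le_trans) => i; case/andP: (xS i).
have anti m n : (m <= n)%N -> x n + 2^-1 ^+ n <= x m + 2^-1 ^+ m.
  apply: (@homo_leq _ (fun n => x n + 2^-1 ^+ n) (fun a b => b <= a)).
  - by move=> ?; exact: lexx.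
  - by move=> b a c ab bc; exact: le_trans bc ab.
  - by move=> i; have /andP[_] := xS i; rewrite (half i); lra.
have pos n : 0 <= 2^-1 ^+ n :> R by rewrite exprn_ge0.
have ub m : ubound (range x) (x m + 2^-1 ^+ m).
  move=> _ [n _ <-]; have [mn|/ltnW nm] := leqP m n.
    by apply: le_trans (anti _ _ mn); rewrite lerDl.
  by apply: le_trans (homo _ _ nm) _; rewrite lerDl.
exists (sup (range x)) => n; apply/andP; split.
  by apply: ub_le_sup; [exists (x 0%N + 2^-1 ^+ 0); exact: ub|exists n].
by apply: ge_sup; [exists (x 0%N), 0%N|exact: ub].
Qed.

(** Goursat's nested squares, detached from integration: a failing square contains a failing square
    of half its side, and the corners of successive failures converge to a point [(p, q)] around
    which the local hypothesis excludes failure. *)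
Lemma square_bisection (P : R -> R -> R -> Prop) :
    (forall x y d, 0 < d -> 0 <= x -> x + d <= 1 -> 0 <= y -> y + d <= 1 ->
       P x y (d / 2) -> P (x + d / 2) y (d / 2) -> P x (y + d / 2) (d / 2) ->
       P (x + d / 2) (y + d / 2) (d / 2) -> P x y d) ->
    (forall p q, 0 <= p <= 1 -> 0 <= q <= 1 -> exists2 e, 0 < e &
       forall x y d, 0 < d < e -> 0 <= x -> x + d <= 1 -> 0 <= y -> y + d <= 1 ->
         x <= p <= x + d -> y <= q <= y + d -> P x y d) ->
  P 0 0 1.
Proof.
move=> Psub Ploc; apply: contrapT => P0.
pose dy (n : nat) : R := 2^-1 ^+ n.
have dyS n : dy n.+1 = dy n / 2 by rewrite /dy exprS mulrC.
have dy0 n : 0 < dy n by rewrite /dy exprn_gt0.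
pose ok (n : nat) (s s' : R * R) := [/\ ~ P s'.1 s'.2 (dy n.+1),
  s.1 <= s'.1 <= s.1 + dy n.+1 & s.2 <= s'.2 <= s.2 + dy n.+1].
(* The default value of [xget] never occurs: [good] below shows that a failing square of half the
   side always exists. *)
pose q := fix q (n : nat) : R * R :=
  if n is m.+1 then xget (q m) [set s' | ok m (q m) s'] else (0, 0).
have inv n : [/\ ~ P (q n).1 (q n).2 (dy n), 0 <= (q n).1, (q n).1 + dy n <= 1,
    0 <= (q n).2 & (q n).2 + dy n <= 1] /\ ok n (q n) (q n.+1).
  have good m : [/\ ~ P (q m).1 (q m).2 (dy m), 0 <= (q m).1, (q m).1 + dy m <= 1,
    0 <= (q m).2 & (q m).2 + dy m <= 1] -> ok m (q m) (q m.+1).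
    move=> [nP x0 x1 y0 y1] /=.
    suff [s hs] : exists s, ok m (q m) s by case: xgetP => [s' _ //|/(_ s)].
    apply: contrapT => no; apply: nP; have d0 := dy0 m; have d1 := dy0 m.+1.
    have bad s : (q m).1 <= s.1 <= (q m).1 + dy m.+1 ->
        (q m).2 <= s.2 <= (q m).2 + dy m.+1 -> P s.1 s.2 (dy m.+1).
      by move=> h1 h2; apply: contrapT => nP; apply: no; exists s.
    have := bad ((q m).1, (q m).2); have := bad ((q m).1 + dy m.+1, (q m).2).
    have := bad ((q m).1, (q m).2 + dy m.+1).
    have := bad ((q m).1 + dy m.+1, (q m).2 + dy m.+1).
    rewrite /= dyS => b1 b2 b3 b4; rewrite dyS in d1.
    have d2 : 0 <= dy m / 2 by rewrite ltW.
    have lo (v : R) : v <= v <= v + dy m / 2 by rewrite lexx lerDl.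
    have hi (v : R) : v <= v + dy m / 2 <= v + dy m / 2 by rewrite lexx lerDl d2.
    by apply: Psub => //; [exact: b4|exact: b3|exact: b2|exact: b1].
  elim: n => [|n [[nP x0 x1 y0 y1] okn]]; first split.
  - by rewrite /= /dy expr0; split=> //; rewrite ?add0r.
  - by apply: good; rewrite /= /dy expr0; split=> //; rewrite ?add0r.
  have inv' : [/\ ~ P (q n.+1).1 (q n.+1).2 (dy n.+1), 0 <= (q n.+1).1,
      (q n.+1).1 + dy n.+1 <= 1, 0 <= (q n.+1).2 & (q n.+1).2 + dy n.+1 <= 1].
    case: okn => nP' h1 h2; split=> //; move: (dy n.+1) (dyS n) h1 h2 => d1 -> h1 h2; lra.
  by split=> //; exact: good.
have [x hx] : exists x, forall n, (q n).1 <= x <= (q n).1 + dy n.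
  by apply: nested_intervals => n; have [_ []] := inv n.
have [y hy] : exists y, forall n, (q n).2 <= y <= (q n).2 + dy n.
  by apply: nested_intervals => n; have [_ []] := inv n.
have [||e e0 he] := Ploc x y.
- by have := hx 0%N; rewrite /dy /= expr0 add0r.
- by have := hy 0%N; rewrite /dy /= expr0 add0r.
have [n hn] := exists_halfpow_lt e0; have [[nP ? ? ? ?] _] := inv n.
by apply: nP; apply: he => //; rewrite dy0.
Qed.

End Bisection.

Section Circle.
Variable R : realType.
Local Notation C := R[i].

Definition circle (r t : R) : C := Complex (r * cos t) (r * sin t).

Lemma norm_circle (r t : R) : 0 <= r -> `|circle r t| = r%:C%C.
Proof.
move=> r0; rewrite normc_def /= !exprMn -mulrDr cos2Dsin2 mulr1.
by rewrite sqrtr_sqr ger0_norm.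
Qed.

Lemma circle2pi (r : R) : circle r (2 * pi) = circle r 0.
Proof. by rewrite /circle mulr_natl cos2pi sin2pi cos0 sin0. Qed.

Lemma cts_circle (r t : R) : cts (circle r) t.
Proof.
apply: cts_complex; apply: continuousM; try exact: cst_continuous.
- exact: continuous_cos.
- exact: continuous_sin.
Qed.

Lemma norm_real (z : C) : exists2 r : R, 0 <= r & `|z| = r%:C%C.
Proof.
exists (complex.Re `|z|); last by rewrite RRe_real // normr_real.
by have := normr_ge0 z; rewrite lecE => /andP[].
Qed.

Lemma cint_circle (r b c : R) : b <= c ->
  cint b c (fun t => 'i%C * circle r t) = circle r c - circle r b.
Proof.
move=> bc.
have Re' t : complex.Re ('i%C * circle r t) = - (r * sin t) by rewrite /=; ring.
have Im' t : complex.Im ('i%C * circle r t) = r * cos t by rewrite /=; ring.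
apply: cint_ftc => //.
- by move=> x _; apply: ctsM; [exact: cts_cst|exact: cts_circle].
- by move=> x; rewrite Re'; apply: is_derive_eq; rewrite /GRing.scale /=; ring.
- by move=> x; rewrite Im'; apply: is_derive_eq; rewrite /GRing.scale /=; ring.
Qed.

End Circle.

(** * The form [dz / (z - a)] in polar coordinates centred at [a] *)

Section RectangleForm.
Variables (R : realType) (r ra : R) (a : R[i]).
Local Notation C := R[i].
Hypotheses (ra0 : 0 <= ra) (rar : ra < r) (aE : `|a| = ra%:C%C).

(** The points [a + s * ray t] with [0 <= s <= 1] fill the disk by segments from [a] to the circle.
    Since the derivative of [circle r] is ['i * circle r], [dlog] below is the logarithmic
    derivative of [ray], and [dz / (z - a) = ds/s + dlog dt]. *)
Definition ray (t : R) : C := circle r t - a.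
Definition dlog (t : R) : C := 'i%C * circle r t / ray t.

Let r0 : 0 < r. Proof. exact: le_lt_trans rar. Qed.

Lemma norm_ray_ge t : (r - ra)%:C%C <= `|ray t|.
Proof.
rewrite rmorphB /= -aE -(norm_circle t (ltW r0)); exact: lerB_dist.
Qed.

Lemma norm_ray_le t : `|ray t| <= (2 * r)%:C%C.
Proof.
apply: le_trans (ler_normB _ _) _.
rewrite aE (norm_circle t (ltW r0)) -rmorphD lecR; move: rar; lra.
Qed.

Lemma ray_neq0 t : ray t != 0.
Proof.
by rewrite -normr_gt0; apply: lt_le_trans (norm_ray_ge t); rewrite ltcR subr_gt0.
Qed.

Lemma cts_ray t : cts ray t.
Proof. by apply: ctsB; [exact: cts_circle|exact: cts_cst]. Qed.

Lemma cts_dlog t : cts dlog t.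
Proof.
apply: ctsM; last by apply: ctsV; [exact: cts_ray|exact: ray_neq0].
by apply: ctsM; [exact: cts_cst|exact: cts_circle].
Qed.

Lemma norm_dlog t : `|dlog t| <= (r / (r - ra))%:C%C.
Proof.
rewrite !normrM norm_imaginary mul1r (norm_circle t (ltW r0)) normfV rmorphM fmorphV /=.
rewrite ler_wpM2l ?lecR ?(ltW r0) // lef_pV2 ?posrE ?normr_gt0 ?ray_neq0 ?norm_ray_ge //.
by rewrite ltcR subr_gt0.
Qed.

Lemma norm_segment s t : 0 <= s <= 1 -> `|a + s%:C%C * ray t| <= r%:C%C.
Proof.
move=> /andP[s0 s1].
have -> : a + s%:C%C * ray t = (1 - s)%:C%C * a + s%:C%C * circle r t.
  by rewrite /ray rmorphB rmorph1; ring.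
apply: le_trans (ler_normD _ _) _; rewrite !normrM aE norm_circle ?(ltW r0) //.
rewrite !norm_real_complex -!rmorphM -rmorphD lecR !ger0_norm ?subr_ge0 //.
have h1 : 0 <= 1 - s by rewrite subr_ge0.
have h2 : 0 <= r - ra by rewrite subr_ge0 ltW.
have := mulr_ge0 h1 h2; lra.
Qed.

Lemma ray_lip t t' : `|ray t - ray t'| <= (2 * r * `|t - t'|)%:C%C.
Proof.
wlog tt : t t' / t' <= t.
  move=> h; have [/h //|/ltW/h] := leP t' t; by rewrite distrC (distrC t).
have -> : ray t - ray t' = circle r t - circle r t' by rewrite /ray; ring.
rewrite -cint_circle // [`|t - t'|]ger0_norm ?subr_ge0 //; apply: cint_le => //.
  by move=> x _; apply: ctsM; [exact: cts_cst|exact: cts_circle].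
by move=> x _; rewrite normrM norm_imaginary mul1r norm_circle ?(ltW r0).
Qed.

(* The integral of the 1-form [H (ds/s + dlog dt)] along the boundary of the
   parameter rectangle [s0, s1] x [t0, t1]. With [H s t = F (a + s * ray t)] this
   is the integral of [F(z) dz / (z - a)] along the image of that boundary. *)
Definition rect_int (H : R -> R -> C) s0 s1 t0 t1 : C :=
  cint t0 t1 (fun t => H s1 t * dlog t) - cint t0 t1 (fun t => H s0 t * dlog t)
  - cint s0 s1 (fun s => H s t1 / s%:C%C) + cint s0 s1 (fun s => H s t0 / s%:C%C).

(** Only integrals along the sides of rectangles are taken, so continuity in each variable
    separately suffices. The lower bound [e] keeps [s] away from the pole of [ds/s]. *)
Definition rect_cont (e : R) (H : R -> R -> C) : Prop :=
  (forall s t, e <= s <= 1 -> cts (H s) t) /\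
  (forall t s, e <= s <= 1 -> cts (H^~ t) s).

Lemma cts_realC (s : R) : cts (fun s => s%:C%C : C) s.
Proof. apply: cts_complex; [exact: cvg_id|exact: cst_continuous]. Qed.

Variable e : R.
Hypotheses (e0 : 0 < e).

Lemma cts_ds (H : R -> R -> C) t s : rect_cont e H -> e <= s <= 1 ->
  cts (fun s => H s t / s%:C%C) s.
Proof.
move=> [_ cH] /andP[es s1]; apply: ctsM; first by apply: cH; rewrite es.
apply: ctsV; first exact: cts_realC.
by rewrite -[0]/(0%:C%C) (inj_eq (@complexI _)) lt0r_neq0 // (lt_le_trans e0).
Qed.

Lemma cts_dt (H : R -> R -> C) t s : rect_cont e H -> e <= s <= 1 ->
  cts (fun t => H s t * dlog t) t.
Proof. by move=> [cH _] h; apply: ctsM; [exact: cH|exact: cts_dlog]. Qed.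

Lemma rect_int_sub_s H s0 sm s1 t0 t1 : rect_cont e H -> e <= s0 -> s0 <= sm -> sm <= s1 ->
  s1 <= 1 -> rect_int H s0 s1 t0 t1 = rect_int H s0 sm t0 t1 + rect_int H sm s1 t0 t1.
Proof.
move=> cH es0 s0m sm1 s11; rewrite /rect_int.
have c t : cts_on s0 s1 (fun s => H s t / s%:C%C).
  by move=> s /andP[h1 h2]; apply: cts_ds => //; lra.
rewrite (cint_itv s0m sm1 (c t1)) (cint_itv s0m sm1 (c t0)); ring.
Qed.

Lemma rect_int_sub_t H s0 s1 t0 tm t1 : rect_cont e H -> e <= s0 -> s0 <= s1 -> s1 <= 1 ->
  t0 <= tm -> tm <= t1 -> rect_int H s0 s1 t0 t1 = rect_int H s0 s1 t0 tm + rect_int H s0 s1 tm t1.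
Proof.
move=> cH es0 s01 s11 h0 h1; rewrite /rect_int.
have c s : e <= s <= 1 -> cts_on t0 t1 (fun t => H s t * dlog t).
  by move=> hs t _; apply: cts_dt.
rewrite (cint_itv h0 h1 (c s1 _)) ?(cint_itv h0 h1 (c s0 _)); [ring| |]; lra.
Qed.

Lemma rect_intD H G s0 s1 t0 t1 : rect_cont e H -> rect_cont e G ->
  e <= s0 -> s0 <= s1 -> s1 <= 1 ->
  rect_int (fun s t => H s t + G s t) s0 s1 t0 t1 = rect_int H s0 s1 t0 t1 + rect_int G s0 s1 t0 t1.
Proof.
move=> cH cG es0 s01 s11; rewrite /rect_int.
have ct K s : rect_cont e K -> e <= s <= 1 -> cts_on t0 t1 (fun t => K s t * dlog t).
  by move=> cK hs t _; apply: cts_dt.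
have cs K t : rect_cont e K -> cts_on s0 s1 (fun s => K s t / s%:C%C).
  by move=> cK s /andP[h1 h2]; apply: cts_ds => //; lra.
have e1 s : e <= s <= 1 -> cint t0 t1 (fun t => (H s t + G s t) * dlog t) =
  cint t0 t1 (fun t => H s t * dlog t) + cint t0 t1 (fun t => G s t * dlog t).
  move=> hs; rewrite -cintD; [|exact: ct|exact: ct].
  by apply: eq_cint => t _; rewrite mulrDl.
have e2 t : cint s0 s1 (fun s => (H s t + G s t) / s%:C%C) =
  cint s0 s1 (fun s => H s t / s%:C%C) + cint s0 s1 (fun s => G s t / s%:C%C).
  rewrite -cintD; [|exact: cs|exact: cs].
  by apply: eq_cint => s _; rewrite mulrDl.
rewrite !e2 e1 ?e1; [ring| |]; lra.
Qed.

Lemma rect_cont_affine (al d : C) : rect_cont e (fun s t => al + d * (s%:C%C * ray t)).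
Proof.
split=> s t _; apply: ctsD; do ?[exact: cts_cst]; apply: ctsM; do ?[exact: cts_cst];
 apply: ctsM; do ?[exact: cts_cst | exact: cts_ray | exact: cts_realC].
Qed.

(** The constant part cancels between opposite sides, because the coefficient of [ds] depends on [s]
    alone and that of [dt] on [t] alone; the linear part is [d] times the exact form with primitive
    [s * ray t]. *)
Lemma rect_int_affine (al d : C) s0 s1 t0 t1 : e <= s0 -> s0 <= s1 -> s1 <= 1 -> t0 <= t1 ->
  rect_int (fun s t => al + d * (s%:C%C * ray t)) s0 s1 t0 t1 = 0.
Proof.
move=> es0 s01 s11 t01; rewrite /rect_int.
have c1 : cts_on t0 t1 (fun t => 'i%C * circle r t).
  by move=> x _; apply: ctsM; [exact: cts_cst|exact: cts_circle].
have c2 : cts_on t0 t1 dlog by move=> x _; apply: cts_dlog.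
have cV : cts_on s0 s1 (fun s => s%:C%C^-1).
  move=> s /andP[h1 h2]; apply: ctsV; first exact: cts_realC.
  by rewrite -[0]/(0%:C%C) (inj_eq (@complexI _)) lt0r_neq0 // (lt_le_trans e0) // (le_trans es0).
have cZ b c f (k : C) : cts_on b c f -> cts_on b c (fun t => k * f t).
  by move=> cf x xb; apply: ctsM; [exact: cts_cst|exact: cf].
have e1 s : cint t0 t1 (fun t => (al + d * (s%:C%C * ray t)) * dlog t) =
   al * cint t0 t1 dlog + d * s%:C%C * (circle r t1 - circle r t0).
  rewrite -cint_circle // -!cintZ // -cintD; try exact: cZ.
  apply: eq_cint => t _; rewrite /dlog; field; exact: ray_neq0.
have e2 t : cint s0 s1 (fun s => (al + d * (s%:C%C * ray t)) / s%:C%C) =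
   al * cint s0 s1 (fun s => s%:C%C^-1) + d * ray t * (s1 - s0)%:C%C.
  rewrite -cint_cst // -cintZ // -cintD; [|exact: cZ|by move=> x _; exact: cts_cst].
  apply: eq_cint => s /andP[h1 _]; field.
  by rewrite -[0]/(0%:C%C) (inj_eq (@complexI _)) lt0r_neq0 // (lt_le_trans e0) // (le_trans es0).
rewrite !e1 !e2 /ray rmorphB; ring.
Qed.

Lemma rect_int_le (H : R -> R -> C) (m K : R) s0 s1 t0 t1 : rect_cont e H ->
  e <= s0 -> s0 <= s1 -> s1 <= 1 -> t0 <= t1 -> 0 <= m ->
  r / (r - ra) <= K -> e^-1 <= K ->
  (forall s t, s0 <= s <= s1 -> t0 <= t <= t1 -> `|H s t| <= m%:C%C) ->
  `|rect_int H s0 s1 t0 t1| <= (4 * m * K * (t1 - t0) + 4 * m * K * (s1 - s0))%:C%C.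
Proof.
move=> cH es0 s01 s11 t01 m0 K1 K2 Hm; rewrite /rect_int.
have ht s : s0 <= s <= s1 ->
    `|cint t0 t1 (fun t => H s t * dlog t)| <= (2 * (m * K) * (t1 - t0))%:C%C.
  move=> hs; apply: cint_le => //.
    move=> t _; apply: cts_dt => //; lra.
  move=> t tt; rewrite normrM rmorphM ler_pM ?Hm //.
  by apply: le_trans (norm_dlog t) _; rewrite lecR.
have hv t : t0 <= t <= t1 ->
    `|cint s0 s1 (fun s => H s t / s%:C%C)| <= (2 * (m * K) * (s1 - s0))%:C%C.
  move=> hs; apply: cint_le => //.
    by move=> s /andP[? ?]; apply: cts_ds => //; lra.
  move=> s ss; have s_gt0 : 0 < s.
    case/andP: ss => h _; apply: lt_le_trans e0 _; exact: le_trans h.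
  rewrite normrM rmorphM ler_pM ?Hm // normfV norm_real_complex -fmorphV lecR.
  rewrite (ger0_norm (ltW s_gt0)).
  by apply: le_trans K2; rewrite lef_pV2 ?posrE //; lra.
apply: le_trans (ler_normD _ _) _.
apply: le_trans (lerD (le_trans (ler_normB _ _) (lerD (ler_normB _ _) (lexx _))) (lexx _)) _.
have [i1 i2] : s0 <= s1 <= s1 /\ s0 <= s0 <= s1 by rewrite !lexx s01.
have [j1 j2] : t0 <= t1 <= t1 /\ t0 <= t0 <= t1 by rewrite !lexx t01.
apply: le_trans (lerD (lerD (lerD (ht s1 i1) (ht s0 i2)) (hv t1 j1)) (hv t0 j2)) _.
rewrite -!rmorphD lecR; lra.
Qed.

End RectangleForm.

Lemma realcM (R : realType) (x y : R) : (x * y)%:C%C = x%:C%C * y%:C%C :> R[i].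
Proof. exact: rmorphM. Qed.

(** * Goursat's estimate and Cauchy's formula *)

Section Goursat.
Variables (R : realType) (r ra : R) (a : R[i]).
Local Notation C := R[i].
Hypotheses (ra0 : 0 <= ra) (rar : ra < r) (aE : `|a| = ra%:C%C).
Variable F : C -> C.
Hypothesis dF : forall z, `|z| <= r%:C%C -> derivable (F : C^o -> C^o) z 1.

Let H (s t : R) : C := F (a + s%:C%C * ray r a t).
Let r0 : 0 < r. Proof. exact: le_lt_trans rar. Qed.

Lemma rect_cont_ray e : 0 < e -> rect_cont e H.
Proof.
move=> e0; split=> s t /andP[es s1].
  apply: (@cts_comp R F (fun t => a + s%:C%C * ray r a t)).
    by apply: ctsD; [exact: cts_cst|apply: ctsM; [exact: cts_cst|exact: cts_ray]].
  apply/derivable_continuous/dF/(norm_segment ra0 rar aE).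
  by rewrite s1 (le_trans (ltW e0)).
apply: (@cts_comp R F (fun s => a + s%:C%C * ray r a _)).
  by apply: ctsD; [exact: cts_cst|apply: ctsM; [exact: cts_realC|exact: cts_cst]].
apply/derivable_continuous/dF/(norm_segment ra0 rar aE).
by rewrite s1 (le_trans (ltW e0)).
Qed.

Lemma normc_eq0_small (w : C) (K : R) : 0 <= K ->
  (forall eta : R, 0 < eta -> `|w| <= (K * eta)%:C%C) -> w = 0.
Proof.
move=> K0 h; have [rho rho0 E] := norm_real w.
have rho1 eta : 0 < eta -> rho <= K * eta by move=> /h; rewrite E lecR.
suff -> : w = 0 by [].
apply/normr0_eq0; rewrite E; congr (_%:C%C); apply/eqP; rewrite eq_le rho0 andbT.
rewrite leNgt; apply/negP => rp.
have K1 : 0 < K + 1 by lra.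
have := rho1 (rho / (2 * (K + 1))) (divr_gt0 rp _) .
have -> : K * (rho / (2 * (K + 1))) = rho / 2 * (K / (K + 1)) by field; rewrite lt0r_neq0.
have KK : K / (K + 1) <= 1 by rewrite ler_pdivrMr //; lra.
move=> /(_ ltac:(lra)); have := ler_wpM2l (_ : 0 <= rho / 2) KK; lra.
Qed.

Lemma affine_bounds (e x d : R) : 0 < e < 1 -> 0 <= x -> 0 <= d -> x + d <= 1 ->
  [/\ e <= e + (1 - e) * x, e + (1 - e) * x <= e + (1 - e) * (x + d) &
      e + (1 - e) * (x + d) <= 1].
Proof.
move=> /andP[e0 e1] x0 d0 xd; have e1' : 0 <= 1 - e by rewrite subr_ge0 ltW.
split; first by rewrite lerDl mulr_ge0.
  by rewrite lerD2l ler_wpM2l // lerDl.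
rewrite -subr_ge0 (_ : _ - _ = (1 - e) * (1 - (x + d))); last by ring.
by rewrite mulr_ge0 // subr_ge0.
Qed.

(** Subtracting the affine approximation at the point with parameters [(p, q)] does not change the
    integral. The remainder is a small multiple of the diameter and the perimeter supplies another
    factor [d], whence a bound quadratic in [d]. The unit square is mapped affinely onto the
    rectangle from [e] to 1 and from 0 to [2 * pi]. *)
Lemma rect_int_loc (e eta p q : R) : 0 < e < 1 -> 0 < eta -> 0 <= p <= 1 ->
  exists2 dl, 0 < dl & forall x y d, 0 < d < dl -> 0 <= x -> x + d <= 1 ->
    0 <= y -> y + d <= 1 -> x <= p <= x + d -> y <= q <= y + d ->
    `|rect_int r a H (e + (1 - e) * x) (e + (1 - e) * (x + d)) (2 * pi * y) (2 * pi * (y + d))|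
       <= (eta * d ^+ 2)%:C%C.
Proof.
move=> e01 eta0 /andP[p0 p1]; have /andP[e0 e1] := e01.
have pi0 : 0 < pi :> R := pi_gt0 R.
pose S x := e + (1 - e) * x; pose T (y : R) := 2 * pi * y.
have e1' : 0 <= 1 - e by lra.
have Sp : 0 <= S p <= 1.
  have p1' : 0 <= 1 - p by lra.
  by have := mulr_ge0 e1' p0; have := mulr_ge0 e1' p1'; rewrite /S; lra.
pose zs := a + (S p)%:C%C * ray r a (T q).
have dzs : derivable (F : C^o -> C^o) zs 1 := dF (norm_segment ra0 rar aE (T q) Sp).
have [d hd] := derivable_eps dzs.
pose K := Num.max (r / (r - ra)) e^-1.
have K0 : 0 < K by rewrite lt_max invr_gt0 e0 orbT.
(* [M * dd] bounds the distance from [zs] to the image of a parameter square of side [dd]: moving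
   [s] costs [|ray| <= 2 * r], moving [t] costs the Lipschitz constant of [ray_lip] times
   [2 * pi]. *)
pose M := 2 * r + 2 * r * (2 * pi).
have M0 : 0 < M by rewrite addr_gt0 ?mulr_gt0.
(* Collects the constants of [rect_int_le], so that an approximation error of [eta / L] ends up as
   [eta * d ^+ 2]. *)
pose L := 4 * M * K * (2 * pi) + 4 * M * K.
have L0 : 0 < L by rewrite addr_gt0 ?mulr_gt0.
have LE : 4 * M * K * (2 * pi) + 4 * M * K = L by [].
clearbody L.
have eL : 0 < (eta / L)%:C%C by rewrite ltcR divr_gt0.
have [dl dl0 hdl] := hd _ eL.
have [dl' dlE] : exists dl' : R, dl = dl'%:C%C.
  by exists (complex.Re dl); rewrite RRe_real // gtr0_real.
rewrite dlE ltcR in dl0 hdl.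
exists (dl' / M); first by rewrite divr_gt0.
move=> x y dd /andP[dd0 dd1] x0 x1 y0 y1 xp yq.
rewrite -/(S x) -/(S (x + dd)) -/(T y) -/(T (y + dd)).
have ptd s t : S x <= s <= S (x + dd) -> T y <= t <= T (y + dd) ->
    `|(a + s%:C%C * ray r a t) - zs| <= (M * dd)%:C%C.
  move=> ss tt; rewrite /zs.
  have -> : a + s%:C%C * ray r a t - (a + (S p)%:C%C * ray r a (T q)) =
     (s - S p)%:C%C * ray r a t + (S p)%:C%C * (ray r a t - ray r a (T q)).
    by rewrite rmorphB /=; ring.
  apply: le_trans (ler_normD _ _) _; rewrite !normrM !norm_real_complex.
  have h1 : `|s - S p| <= dd.
    rewrite ler_norml; move: ss; rewrite /S => ss.
    case/andP: xp; rewrite -subr_ge0 => xp; rewrite -subr_ge0 => px.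
    have := mulr_ge0 e1' xp; have := mulr_ge0 e1' px; have := mulr_ge0 (ltW e0) (ltW dd0); lra.
  have h2 : `|t - T q| <= 2 * pi * dd.
    rewrite ler_norml; move: tt; rewrite /T => tt.
    case/andP: yq; rewrite -subr_ge0 => yq; rewrite -subr_ge0 => qy.
    have := mulr_ge0 (ltW pi0) yq; have := mulr_ge0 (ltW pi0) qy; lra.
  have h3 : `|S p| <= 1 by rewrite ger0_norm; case/andP: Sp.
  have i1 : `|s - S p|%:C%C * `|ray r a t| <= (dd * (2 * r))%:C%C.
    rewrite rmorphM /=; apply: ler_pM => //; first by rewrite ler0c.
      by rewrite lecR.
    exact: (norm_ray_le ra0 rar aE).
  have h4 : `|ray r a t - ray r a (T q)| <= (2 * r * (2 * pi * dd))%:C%C.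
    apply: le_trans (ray_lip a ra0 rar t (T q)) _.
    by rewrite lecR ler_pM2l // mulr_gt0.
  have i2 : `|S p|%:C%C * `|ray r a t - ray r a (T q)| <= (1 * (2 * r * (2 * pi * dd)))%:C%C.
    rewrite rmorphM; apply: ler_pM => //; first by rewrite ler0c.
    by rewrite lecR.
  apply: le_trans (lerD i1 i2) _; rewrite -rmorphD lecR le_eqVlt.
  by apply/orP; left; apply/eqP; rewrite /M; ring.
pose al := F zs - d * (zs - a).
pose G s t := H s t - (al + d * (s%:C%C * ray r a t)).
have cH := rect_cont_ray e0; have cA := rect_cont_affine r a e al d.
have cG : rect_cont e G.
  case: cH cA => [cH1 cH2] [cA1 cA2].
  split=> s t st; apply: ctsB; [exact: cH1|exact: cA1|exact: cH2|exact: cA2].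
have Gm s t : S x <= s <= S (x + dd) -> T y <= t <= T (y + dd) ->
    `|G s t| <= (eta / L * (M * dd))%:C%C.
  move=> ss tt; have D := ptd s t ss tt.
  have -> : G s t = F (a + s%:C%C * ray r a t) - F zs - d * ((a + s%:C%C * ray r a t) - zs).
    by rewrite /G /H /al; ring.
  apply: le_trans (hdl _ _) _.
    by apply: le_lt_trans D _; rewrite ltcR mulrC -ltr_pdivlMr.
  by rewrite (realcM (eta / L)); apply: ler_wpM2l => //; exact: ltW.
have [eS SS S1] := affine_bounds e01 x0 (ltW dd0) x1.
have TT : T y <= T (y + dd) by rewrite ler_wpM2l ?lerDl ?ltW // mulr_gt0.
have HE : H = fun s t => G s t + (al + d * (s%:C%C * ray r a t)).
  by apply/funext => s; apply/funext => t; rewrite /G subrK.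
have -> : rect_int r a H (S x) (S (x + dd)) (T y) (T (y + dd)) =
    rect_int r a G (S x) (S (x + dd)) (T y) (T (y + dd)).
  have D := rect_intD ra0 rar aE e0 (T y) (T (y + dd)) cG cA eS SS S1.
  rewrite (rect_int_affine ra0 rar aE e0 al d eS SS S1 TT) addr0 in D.
  by rewrite -D -HE.
have m0 : 0 <= eta / L * (M * dd) by rewrite mulr_ge0 ?divr_ge0 ?mulr_ge0 // ltW.
have := rect_int_le ra0 rar aE e0 cG eS SS S1 TT m0 _ _ Gm => /(_ K).
rewrite !le_max !lexx orbT => /(_ isT isT) /le_trans; apply; rewrite lecR.
have -> : eta * dd ^+ 2 =
    4 * (eta / L * (M * dd)) * K * (2 * pi * dd) + 4 * (eta / L * (M * dd)) * K * dd.
  transitivity (eta / L * dd ^+ 2 * (4 * M * K * (2 * pi) + 4 * M * K)); last by ring.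
  by rewrite LE; field; rewrite lt0r_neq0.
rewrite lerD // /S /T.
- by have -> : 2 * pi * (y + dd) - 2 * pi * y = 2 * pi * dd by ring.
- have k0 : 0 <= 4 * (eta / L * (M * dd)) * K by rewrite mulr_ge0 ?(ltW K0) // mulr_ge0.
  apply: ler_wpM2l => //.
  have -> : e + (1 - e) * (x + dd) - (e + (1 - e) * x) = (1 - e) * dd by ring.
  by rewrite ler_piMl ?(ltW dd0) // lerBlDr lerDl ltW.
Qed.

(** The bound [eta * d ^+ 2] reproduces itself under quartering, since four times [(d / 2) ^+ 2] is
    [d ^+ 2] and inner sides cancel. Bisection thus gives it for the whole rectangle, with [eta]
    arbitrary. *)
Lemma rect_int_holomorphic (e : R) : 0 < e < 1 -> rect_int r a H e 1 0 (2 * pi) = 0.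
Proof.
move=> e01; have /andP[e0 e1] := e01; have pi0 : 0 < pi :> R := pi_gt0 R.
have e1' : 0 <= 1 - e by lra.
apply: (normc_eq0_small ler01) => eta eta0; rewrite mul1r.
pose W x y d := rect_int r a H (e + (1 - e) * x) (e + (1 - e) * (x + d))
  (2 * pi * y) (2 * pi * (y + d)).
have := @square_bisection R (fun x y d => `|W x y d| <= (eta * d ^+ 2)%:C%C).
have -> : W 0 0 1 = rect_int r a H e 1 0 (2 * pi).
  by rewrite /W !mulr0 !add0r !mulr1 addr0 (_ : e + (1 - e) = 1) //; ring.
rewrite expr1n mulr1; apply; last first.
  by move=> p q hp hq; exact: rect_int_loc.
move=> x y d d0 x0 x1 y0 y1 h1 h2 h3 h4.
have cH := rect_cont_ray e0.
have d2 : 0 <= d / 2 by rewrite divr_ge0 // ltW.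
have xE : x + d = (x + d / 2) + d / 2 by rewrite -addrA -splitr.
have yE : y + d = (y + d / 2) + d / 2 by rewrite -addrA -splitr.
have E : W x y d = (W x y (d / 2) + W (x + d / 2) y (d / 2)) +
    (W x (y + d / 2) (d / 2) + W (x + d / 2) (y + d / 2) (d / 2)).
  rewrite xE in x1; have xd2 : x + d / 2 <= 1 by apply: le_trans x1; rewrite lerDl.
  have [eS S1 _] := affine_bounds e01 x0 d2 xd2.
  have [eS' S1' S2] := affine_bounds e01 (addr_ge0 x0 d2) d2 x1.
  have T1 (v : R) : 2 * pi * v <= 2 * pi * (v + d / 2).
    by rewrite ler_wpM2l ?lerDl // mulr_ge0 // ltW.
  rewrite /W xE yE.
  rewrite (rect_int_sub_t ra0 rar aE cH eS (le_trans S1 S1') S2 (T1 y) (T1 (y + d / 2))).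
  by congr (_ + _); exact: (rect_int_sub_s r a e0 _ _ cH eS S1 S1' S2).
rewrite E; apply: le_trans (ler_normD _ _) _.
have h12 := le_trans (ler_normD _ _) (lerD h1 h2).
have h34 := le_trans (ler_normD _ _) (lerD h3 h4).
apply: le_trans (lerD h12 h34) _.
by rewrite -!rmorphD lecR le_eqVlt; apply/orP; left; apply/eqP; field.
Qed.

(** The sides [t = 0] and [t = 2 * pi] cancel by periodicity, so the integral over the curve at
    parameter [s] does not depend on [s], and the curve shrinks to [a] as [s] tends to 0. The
    integral of [dlog] is left unevaluated here; its value comes out of the mean value property of
    the Szego kernel. *)
Lemma cauchy_circle : cint 0 (2 * pi) (fun t => F (circle r t) * dlog r a t) =
  F a * cint 0 (2 * pi) (dlog r a).
Proof.
have pi0 : 0 < pi :> R := pi_gt0 R.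
have pi2 : 0 <= 2 * pi :> R by rewrite mulr_ge0 // ltW.
pose J (s : R) := cint 0 (2 * pi) (fun t => H s t * dlog r a t).
have cJ s : 0 < s <= 1 -> cts_on 0 (2 * pi) (fun t => H s t * dlog r a t).
  by move=> /andP[s0 s1] t _; apply: (cts_dt ra0 rar aE (rect_cont_ray s0)); rewrite lexx s1.
have cd : cts_on 0 (2 * pi) (dlog r a) by move=> t _; exact: (cts_dlog ra0 rar aE).
have J1 : J 1 = cint 0 (2 * pi) (fun t => F (circle r t) * dlog r a t).
  by apply: eq_cint => t _; rewrite /H /ray rmorph1 mul1r addrC subrK.
have Je e : 0 < e < 1 -> J e = J 1.
  move=> /rect_int_holomorphic; rewrite /rect_int /J.
  have -> : (fun s : R => H s (2 * pi) / s%:C%C) = (fun s : R => H s 0 / s%:C%C).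
    by apply/funext => s; rewrite /H /ray circle2pi.
  by rewrite subrK => /eqP; rewrite subr_eq0 => /eqP.
pose K := r / (r - ra).
have K0 : 0 <= K by rewrite divr_ge0 ?subr_ge0 // ltW.
rewrite -J1; apply/eqP; rewrite -subr_eq0; apply/eqP.
apply: (@normc_eq0_small _ (2 * K * (2 * pi - 0))) => [|eta eta0].
  by rewrite subr0 mulr_ge0 // mulr_ge0.
have aR : `|a| <= r%:C%C by rewrite aE lecR ltW.
have [dl dl0 hdl] : exists2 dl : R, 0 < dl &
    forall z, `|z - a| < dl%:C%C -> `|F z - F a| <= eta%:C%C.
  have eta1 : 0 < eta%:C%C :> C by rewrite ltcR.
  have /cvgr_dist_lt/(_ _ eta1)/nbhs_ballP[dl /= dl0 hdl] := derivable_continuous (dF aR).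
  exists (complex.Re dl); first by rewrite -ltcR RRe_real // gtr0_real.
  move=> z; rewrite RRe_real ?gtr0_real // => za.
  by rewrite distrC ltW //; apply: hdl; rewrite /ball /= distrC.
(* The first bound keeps [e] below 1; as [|ray| <= 2 * r], the second puts [a + e * ray t] within
   [dl / 2] of [a]. *)
pose e := Num.min (2^-1) (dl / (4 * r)).
have e01 : 0 < e < 1.
  rewrite lt_min gt_min invr_gt0 ltr0n divr_gt0 ?mulr_gt0 //=.
  by rewrite invf_lt1 ?ltr0n // ltr1n.
have e01' : 0 < e <= 1 by case/andP: e01 => -> /ltW.
have cK : cts_on 0 (2 * pi) (fun t => F a * dlog r a t).
  by move=> x xx; apply: ctsM; [exact: cts_cst|exact: cd].
rewrite -(Je e e01) -(cintZ _ cd) -(cintB (cJ e e01') cK).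
have -> : 2 * K * (2 * pi - 0) * eta = 2 * (eta * K) * (2 * pi - 0) by ring.
apply: (cint_le pi2).
  by move=> x xx; apply: ctsB; [exact: (cJ e e01' x xx)|exact: cK].
move=> t _; rewrite -mulrBl normrM rmorphM; apply: ler_pM => //; last exact: (norm_dlog ra0 rar aE).
apply: hdl; rewrite addrC addKr normrM norm_real_complex.
have le2r := norm_ray_le ra0 rar aE t.
have [e0 _] := andP e01.
rewrite (ger0_norm (ltW e0)).
apply: le_lt_trans (_ : e%:C%C * (2 * r)%:C%C < _).
  by apply: ler_wpM2l => //; rewrite ler0c ltW.
rewrite -rmorphM ltcR.
apply: le_lt_trans (_ : dl / (4 * r) * (2 * r) < _).
  by rewrite ler_wpM2r ?mulr_ge0 ?(ltW r0) // ge_min lexx orbT.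
have -> : dl / (4 * r) * (2 * r) = dl / 2 by field; rewrite lt0r_neq0.
by rewrite ltr_pdivrMr // ltr_pMr // ltr1n.
Qed.

End Goursat.

(** * Positivity of the Pick matrix of a Schur function *)

Section PickNecessity.
Variable R : realType.
Local Notation C := R[i].

(** An approximating [y >= 0] is real, so it controls the imaginary part of [c] as well as the sign
    of its real part. The positivity arguments below pass to the limit through this lemma. *)
Lemma ge0_closed (c : C) :
  (forall e : R, 0 < e -> exists2 y : C, 0 <= y & `|c - y| < e%:C%C) -> 0 <= c.
Proof.
move=> h; have I0 : complex.Im c = 0.
  apply/eqP; apply: contraT => nz.
  have e0 : 0 < `|complex.Im c| by rewrite normr_gt0.
  have [y y0 cy] := h _ e0; have := le_lt_trans (normc_ge_Im _) cy.
  by move: y0; rewrite lecE /= raddfB /= => /andP[/eqP -> _]; rewrite subr0 ltcR ltxx.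
rewrite lecE /= I0 eqxx /= leNgt; apply/negP => neg.
have e0 : 0 < - complex.Re c by rewrite oppr_gt0.
have [y y0 cy] := h _ e0; have := le_lt_trans (normc_ge_Re _) cy.
move: y0; rewrite lecE /= => /andP[_ y0].
rewrite raddfB /= ltcR => /lt_le_trans/(_ (lexx _)); rewrite ltr_norml; lra.
Qed.

Lemma cts_on_sum a b n (h : 'I_n -> R -> C) : (forall i, cts_on a b (h i)) ->
  cts_on a b (fun t => \sum_i h i t).
Proof.
move=> ch x xab; elim: n h ch => [|n IHn] h ch.
  by under eq_fun do rewrite big_ord0; apply: cts_cst.
under eq_fun do rewrite big_ord_recl.
by apply: ctsD; [exact: ch|apply: IHn => i; exact: ch].
Qed.

Lemma cint_sum a b n (h : 'I_n -> R -> C) : a <= b -> (forall i, cts_on a b (h i)) ->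
  cint a b (fun t => \sum_i h i t) = \sum_i cint a b (h i).
Proof.
move=> ab; elim: n h => [|n IHn] h ch.
  under eq_fun do rewrite big_ord0.
  by rewrite big_ord0 cint_cst // mul0r.
under eq_fun do rewrite big_ord_recl.
rewrite cintD; [|exact: ch|by apply: cts_on_sum => i; exact: ch].
by rewrite big_ord_recl IHn.
Qed.

Lemma derivable_sum n (h : 'I_n -> C -> C) (z : C) :
  (forall i, derivable (h i : C^o -> C^o) z 1) ->
  derivable (fun y : C^o => \sum_i h i y : C^o) z 1.
Proof.
elim: n h => [|n IHn] h dh.
  by under eq_fun do rewrite big_ord0; apply: derivable_cst.
under eq_fun do rewrite big_ord_recl.
by apply: derivableD; [exact: dh|apply: IHn => i; exact: dh].
Qed.

Lemma mean_value (r : R) (F : C -> C) : 0 < r ->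
  (forall z : C, `|z| <= r%:C%C -> derivable (F : C^o -> C^o) z 1) ->
  cint 0 (2 * pi) (fun t => F (circle r t)) = (2 * pi)%:C%C * F 0.
Proof.
move=> r0 dF.
have n0 : `|0 : C| = 0%:C%C by rewrite normr0.
have pi2 : 0 <= 2 * pi :> R by rewrite mulr_ge0 // pi_ge0.
have i0 : 'i%C != 0 :> C by rewrite -normr_eq0 norm_imaginary oner_eq0.
have dE t : dlog r 0 t = 'i%C.
  by rewrite /dlog /ray subr0 mulfK // -normr_eq0 norm_circle ?(ltW r0) //
    -[0]/(0%:C%C) (inj_eq (@complexI _)) lt0r_neq0.
have cF : cts_on 0 (2 * pi) (fun t => F (circle r t)).
  move=> t _; apply: (@cts_comp R F); first exact: cts_circle.
  by apply/derivable_continuous/dF; rewrite norm_circle ?(ltW r0).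
have := cauchy_circle (lexx 0) r0 n0 dF.
rewrite (eq_cint (f := dlog r 0) (g := fun=> 'i%C)) => [|t _]; last exact: dE.
rewrite cint_cst // subr0.
have -> : cint 0 (2 * pi) (fun t => F (circle r t) * dlog r 0 t) =
    'i%C * cint 0 (2 * pi) (fun t => F (circle r t)).
  by rewrite -cintZ //; apply: eq_cint => t _; rewrite dE mulrC.
by rewrite mulrCA => /(mulfI i0) ->; rewrite mulrC.
Qed.

(** Reproducing kernel at [a] of the Hardy space of the disk of radius [r]. *)
Definition szego (r : R) (a z : C) : C := (1 - a^* * z / (r ^+ 2)%:C%C)^-1.

Lemma szego_den_neq0 (r : R) (a z : C) : 0 < r -> `|a| < r%:C%C -> `|z| <= r%:C%C ->
  1 - a^* * z / (r ^+ 2)%:C%C != 0.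
Proof.
move=> r0 ar zr; rewrite subr_eq0; apply/eqP => /(congr1 Num.norm).
rewrite normr1 !normrM normfV norm_conjC norm_real_complex (ger0_norm (exprn_ge0 2 (ltW r0))).
move=> E; have : `|a| * `|z| < (r ^+ 2)%:C%C.
  rewrite expr2 realcM; apply: (@le_lt_trans _ _ (`|a| * r%:C%C)).
    exact: ler_wpM2l.
  by rewrite ltr_pM2r // ltcR.
have r20 : 0 < (r ^+ 2)%:C%C :> C by rewrite ltcR exprn_gt0.
by rewrite -[X in _ < X]mul1r -ltr_pdivrMr // -E ltxx.
Qed.

Lemma derivable_szego (r : R) (a z : C) : 0 < r -> `|a| < r%:C%C -> `|z| <= r%:C%C ->
  derivable (szego r a : C^o -> C^o) z 1.
Proof.
move=> r0 ar zr; apply: derivableV; first exact: szego_den_neq0.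
apply: derivableB; first exact: derivable_cst.
apply: derivableM; last exact: derivable_cst.
by apply: derivableM; [exact: derivable_cst|exact: derivable_id].
Qed.

(** On the circle [z z^* = r^2], which turns the Cauchy kernel into the conjugate of the Szego
    kernel. *)
Lemma szego_conj (r : R) (a : C) t : 0 < r -> `|a| < r%:C%C ->
  dlog r a t = 'i%C * (szego r a (circle r t))^*.
Proof.
move=> r0 ar; rewrite /dlog /ray /szego fmorphV rmorphB rmorph1 !rmorphM fmorphV /= conjCK.
have cN : circle r t != 0.
  by rewrite -normr_eq0 norm_circle ?(ltW r0) // -[0]/(0%:C%C) (inj_eq (@complexI _)) lt0r_neq0.
have cc : circle r t * (circle r t)^* = r%:C%C * r%:C%C.
  by rewrite -normCK norm_circle ?(ltW r0) // expr2.
have -> : (r%:C%C * r%:C%C)^* = circle r t * (circle r t)^* :> C.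
  by rewrite -cc rmorphM /= conjCK mulrC.
have ccN : (circle r t)^* != 0 by rewrite conjC_eq0.
rewrite -mulrA; congr (_ * _).
have -> : 1 - a * (circle r t)^* / (circle r t * (circle r t)^* ) = (circle r t - a) / circle r t.
  by field; rewrite cN ccN.
by rewrite invfM invrK mulrC.
Qed.

Lemma szego_reproducing (r : R) (a : C) (F : C -> C) : 0 < r -> `|a| < r%:C%C ->
  (forall z : C, `|z| <= r%:C%C -> derivable (F : C^o -> C^o) z 1) ->
  cint 0 (2 * pi) (fun t => F (circle r t) * (szego r a (circle r t))^* ) =
    (2 * pi)%:C%C * F a.
Proof.
move=> r0 ar dF; have [ra ra0 aE] := norm_real a.
have rar : ra < r by rewrite -ltcR -aE.
have i0 : 'i%C != 0 :> C by rewrite -normr_eq0 norm_imaginary oner_eq0.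
have cS : cts_on 0 (2 * pi) (fun t => szego r a (circle r t)).
  move=> t _; apply: (@cts_comp R (szego r a)); first exact: cts_circle.
  by apply/derivable_continuous/derivable_szego; rewrite ?norm_circle ?(ltW r0).
have cE t : (szego r a (circle r t))^* = - 'i%C * dlog r a t.
  by rewrite szego_conj // mulrA mulNr mulCii opprK mul1r.
have cSc : cts_on 0 (2 * pi) (fun t => (szego r a (circle r t))^* ).
  move=> t _; under eq_fun do rewrite cE.
  by apply: ctsM; [exact: cts_cst|exact: (cts_dlog ra0 rar aE)].
have cF : cts_on 0 (2 * pi) (fun t => F (circle r t)).
  move=> t _; apply: (@cts_comp R F); first exact: cts_circle.
  by apply/derivable_continuous/dF; rewrite norm_circle ?(ltW r0).
have := cauchy_circle ra0 rar aE dF.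
rewrite (eq_cint (f := dlog r a) (g := fun t => 'i%C * (szego r a (circle r t))^* ))
  => [|t _]; last exact: szego_conj.
rewrite (cintZ _ cSc) (cint_conj cS).
(* The integral of [dlog] is evaluated here: it is ['i] times the conjugate mean of the holomorphic
   Szego kernel, whose value at 0 is 1. *)
have -> := mean_value r0 (fun z => @derivable_szego r a z r0 ar).
have -> : szego r a 0 = 1 by rewrite /szego mulr0 mul0r subr0 invr1.
rewrite mulr1.
have -> : cint 0 (2 * pi) (fun t => F (circle r t) * dlog r a t) =
    'i%C * cint 0 (2 * pi) (fun t => F (circle r t) * (szego r a (circle r t))^* ).
  rewrite -cintZ; first by apply: eq_cint => t _; rewrite szego_conj // mulrCA.
  by move=> t tt; apply: ctsM; [exact: cF|exact: cSc].
rewrite mulrCA => /(mulfI i0) ->; rewrite mulrC; congr (_ * _).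
by rewrite /Num.conj /= oppr0.
Qed.

Lemma cts_circle_comp (r : R) (F : C -> C) t : 0 < r ->
  (forall z : C, `|z| <= r%:C%C -> derivable (F : C^o -> C^o) z 1) ->
  cts (fun t => F (circle r t)) t.
Proof.
move=> r0 dF; apply: (@cts_comp R F); first exact: cts_circle.
by apply/derivable_continuous/dF; rewrite norm_circle ?(ltW r0).
Qed.

Lemma cts_conj (h : R -> C) t : cts h t -> cts (fun t => (h t)^* ) t.
Proof.
move=> ch; have -> : (fun t => (h t)^* ) = (fun t => (complex.Re (h t) +i* (- complex.Im (h t)))%C).
  by apply/funext => s; case: (h s).
by apply: cts_complex; [exact: cts_Re|apply: continuousN; exact: cts_Im].
Qed.

Lemma szego_sum_reproducing (r : R) n (p y : 'I_n -> C) (F : C -> C) : 0 < r ->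
    (forall j, `|p j| < r%:C%C) ->
    (forall z : C, `|z| <= r%:C%C -> derivable (F : C^o -> C^o) z 1) ->
  cint 0 (2 * pi) (fun t => F (circle r t) * (\sum_j y j * szego r (p j) (circle r t))^* ) =
    (2 * pi)%:C%C * \sum_j (y j)^* * F (p j).
Proof.
move=> r0 pr dF; have pi2 : 0 <= 2 * pi :> R by rewrite mulr_ge0 // pi_ge0.
pose h j t := F (circle r t) * (szego r (p j) (circle r t))^*.
have ch j : cts_on 0 (2 * pi) (h j).
  move=> t _; apply: ctsM; first exact: (cts_circle_comp r0 dF).
  apply: (@cts_conj (fun t => szego r (p j) (circle r t))).
  by apply: (cts_circle_comp (F := szego r (p j)) r0) => z; exact: (derivable_szego r0 (pr j)).
have cyh j : cts_on 0 (2 * pi) (fun t => (y j)^* * h j t).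
  by move=> t tt; apply: ctsM; [exact: cts_cst|exact: ch].
transitivity (cint 0 (2 * pi) (fun t => \sum_j (y j)^* * h j t)).
  apply: eq_cint => t _; rewrite rmorph_sum mulr_sumr; apply: eq_bigr => j _.
  by rewrite rmorphM mulrCA.
rewrite (cint_sum pi2 cyh) mulr_sumr; apply: eq_bigr => j _.
have E : cint 0 (2 * pi) (h j) = _ := szego_reproducing r0 (pr j) dF.
by rewrite (cintZ _ (ch j)) E mulrCA.
Qed.

(** [g] is the image of [G] under the adjoint of multiplication by [f], and the form is the squared
    norm of [G] minus that of [g]. By the reproducing property the inner product of [f g] with [G]
    equals the squared norm of [g], so this difference is, up to [2 * pi], the integral of
    [|G - f g|^2 + |g|^2 (1 - |f|^2)]. *)
Lemma schur_pick_radius (f : C -> C) (r : R) n (p x : 'I_n -> C) : schur_class R f ->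
    0 < r < 1 -> (forall j, `|p j| < r%:C%C) ->
  0 <= \sum_i \sum_j x i * (x j)^* * ((1 - f (p i) * (f (p j))^* ) * szego r (p j) (p i)).
Proof.
move=> [holf f1] /andP[r0 r1] pr.
have pi0 : 0 < 2 * pi :> R by rewrite mulr_gt0 // pi_gt0.
have disk z : `|z| <= r%:C%C -> unit_disk R z.
  by move=> zr; apply: le_lt_trans zr _; rewrite ltcR.
have df (z : C) : `|z| <= r%:C%C -> derivable (f : C^o -> C^o) z 1.
  by move=> zr; apply/holf/disk.
pose G z := \sum_j (x j)^* * szego r (p j) z.
pose g z := \sum_j ((x j)^* * (f (p j))^* ) * szego r (p j) z.
have dcomb (y : 'I_n -> C) (z : C) : `|z| <= r%:C%C ->
    derivable (fun z : C^o => \sum_j y j * szego r (p j) z : C^o) z 1.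
  move=> zr; apply: derivable_sum => j; apply: derivableM; first exact: derivable_cst.
  exact: derivable_szego.
have dG (z : C) : `|z| <= r%:C%C -> derivable (G : C^o -> C^o) z 1 by exact: dcomb.
have dg (z : C) : `|z| <= r%:C%C -> derivable (g : C^o -> C^o) z 1 by exact: dcomb.
have dfg (z : C) : `|z| <= r%:C%C -> derivable ((fun z => f z * g z) : C^o -> C^o) z 1.
  by move=> zr; apply: derivableM; [exact: df|exact: dg].
have cc (u v : C -> C) : (forall z : C, `|z| <= r%:C%C -> derivable (u : C^o -> C^o) z 1) ->
    (forall z : C, `|z| <= r%:C%C -> derivable (v : C^o -> C^o) z 1) ->
    cts_on 0 (2 * pi) (fun t => u (circle r t) * (v (circle r t))^* ).
  move=> du dv t _; apply: ctsM; first exact: (cts_circle_comp r0 du).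
  exact: (@cts_conj (fun t => v (circle r t)) t (cts_circle_comp r0 dv)).
pose A := \sum_i x i * G (p i); pose B := \sum_i x i * (f (p i) * g (p i)).
have IA : cint 0 (2 * pi) (fun t => G (circle r t) * (G (circle r t))^* ) = (2 * pi)%:C%C * A.
  rewrite (szego_sum_reproducing _ r0 pr dG); congr (_ * _).
  by apply: eq_bigr => j _; rewrite conjCK.
pose fgG t := f (circle r t) * g (circle r t) * (G (circle r t))^*.
have IB : cint 0 (2 * pi) fgG = (2 * pi)%:C%C * B.
  rewrite (szego_sum_reproducing _ r0 pr dfg); congr (_ * _).
  by apply: eq_bigr => j _; rewrite conjCK.
have Ig : cint 0 (2 * pi) (fun t => g (circle r t) * (g (circle r t))^* ) = (2 * pi)%:C%C * B.
  rewrite (szego_sum_reproducing _ r0 pr dg); congr (_ * _).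
  by apply: eq_bigr => j _; rewrite rmorphM /= !conjCK mulrA.
have Bc : ((2 * pi)%:C%C * B)^* = (2 * pi)%:C%C * B.
  rewrite -Ig -(cint_conj (cc g g dg dg)); apply: eq_cint => t _.
  by rewrite rmorphM /= conjCK mulrC.
have c1 := cc G G dG dG; have c2 : cts_on 0 (2 * pi) fgG := cc _ G dfg dG; have c3 := cc g g dg dg.
have c2' : cts_on 0 (2 * pi) (fun t => (fgG t)^* ).
  by move=> t tt; exact: (@cts_conj fgG t (c2 t tt)).
have c12 : cts_on 0 (2 * pi) (fun t => G (circle r t) * (G (circle r t))^* - fgG t).
  by move=> t tt; apply: ctsB; [exact: c1|exact: c2].
have c3' : cts_on 0 (2 * pi) (fun t => g (circle r t) * (g (circle r t))^* - (fgG t)^* ).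
  by move=> t tt; apply: ctsB; [exact: c3|exact: c2'].
have := cintD c12 c3'; rewrite (cintB c1 c2) (cintB c3 c2') (cint_conj c2) IA IB Ig Bc subrr addr0.
set I := cint _ _ _ => IE.
have I0 : 0 <= I.
  apply: cint_ge0 => t _; rewrite /fgG; set z := circle r t.
  have fz : `|f z| <= 1 by apply/f1/disk; rewrite norm_circle ?(ltW r0).
  rewrite (_ : _ + _ = `|G z - f z * g z| ^+ 2 + `|g z| ^+ 2 * (1 - `|f z| ^+ 2)).
    by rewrite addr_ge0 ?exprn_ge0 // mulr_ge0 ?exprn_ge0 // subr_ge0 exprn_ile1.
  by rewrite !normCK !(rmorphB, rmorphM) /= conjCK; ring.
have : 0 <= A - B.
  by move: I0; rewrite IE -mulrBr pmulr_rge0 // ltcR.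
congr (0 <= _); rewrite /A /B -sumrB; apply: eq_bigr => i _.
rewrite /G /g !mulr_sumr -sumrB; apply: eq_bigr => j _; ring.
Qed.

Lemma max_norm_lt1 n (p : 'I_n -> C) : (forall j, `|p j| < 1) ->
  exists2 m : R, 0 < m < 1 & forall j, `|p j| < m%:C%C.
Proof.
elim: n p => [|n IHn] p p1; first by exists 2^-1; [lra|case].
have [m /andP[m0 m1] hm] := IHn (fun j => p (lift 0 j)) (fun j => p1 _).
have [a a0 aE] := norm_real (p 0).
have a1 : a < 1 by rewrite -ltcR -aE p1.
have a2 : a < (a + 1) / 2 by lra.
exists (Num.max m ((a + 1) / 2)).
  by rewrite lt_max m0 gt_max m1 /=; lra.
move=> j; case: (unliftP 0 j) => [k ->|->].
  by apply: lt_le_trans (hm k) _; rewrite lecR le_max lexx.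
by rewrite aE ltcR lt_max a2 orbT.
Qed.

(** The nodes stay in a disk of radius [m < 1], so the inequality on radius [r] holds for every [r]
    between [m] and 1, and its left-hand side is continuous at [r = 1]. *)
Theorem schur_pick (f : C -> C) n (p : 'I_n -> C) x : schur_class R f ->
  (forall j, `|p j| < 1) -> 0 <= qform (pickmx p (fun j => f (p j))) x.
Proof.
move=> sf p1; have [m /andP[m0 m1] hm] := max_norm_lt1 p1.
pose phi (r : R) := \sum_i \sum_j x 0 i * (x 0 j)^* *
  ((1 - f (p i) * (f (p j))^* ) * szego r (p j) (p i)).
have -> : qform (pickmx p (fun j => f (p j))) x = phi 1.
  rewrite qformE; apply: eq_bigr => i _; apply: eq_bigr => j _.
  by rewrite mxE /szego expr1n divr1 (mulrC (p i)).
have cphi : cts phi 1.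
  have cs n' (h : 'I_n' -> R -> C) : (forall i, cts (h i) 1) -> cts (fun t => \sum_i h i t) 1.
    by move=> ch; apply: (@cts_on_sum 1 1 n' h) => [i t|]; rewrite ?lexx // => /le_anti <-.
  apply: (cs n) => i; apply: (cs n) => j; apply: ctsM; first exact: cts_cst.
  apply: ctsM; first exact: cts_cst.
  apply: ctsV; last first.
    rewrite expr1n divr1 mulrC subr1_conjM_neq0 // ltW //.
  apply: ctsB; first exact: cts_cst.
  apply: ctsM; first exact: cts_cst.
  apply: ctsV; last by rewrite expr1n oner_eq0.
  rewrite (_ : (fun t : R => (t ^+ 2)%:C%C) = (fun t : R => t%:C%C * t%:C%C :> C)).
    by apply: ctsM; exact: cts_realC.
  by apply/funext => t; rewrite expr2 realcM.
apply: ge0_closed => e e0.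
have e1 : 0 < e%:C%C :> C by rewrite ltcR.
have /cvgr_dist_lt/(_ _ e1)/nbhs_ballP[dl /= dl0 hdl] := cphi.
pose r := 1 - Num.min (dl / 2) ((1 - m) / 2).
have [r1 r2] : m < r < 1 /\ `|1 - r| < dl.
  rewrite /r subKr; case: (leP (dl / 2)) => h; rewrite ger0_norm; lra.
exists (phi r); last exact: hdl.
apply: schur_pick_radius => //; first lra.
by move=> j; apply: lt_trans (hm j) _; rewrite ltcR; lra.
Qed.

End PickNecessity.

(** * The case where no Blaschke factor helps *)

Section Rational.
Variable R : realType.
Local Notation C := R[i].

Lemma derivable_horner (p : {poly C}) (z : C) :
  derivable ((fun y => p.[y]) : C^o -> C^o) z 1.
Proof.
elim/poly_ind: p => [|p c IH].
  rewrite (_ : (fun y => _) = fun=> 0); first exact: derivable_cst.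
  by apply/funext => y; rewrite horner0.
rewrite (_ : (fun y => _) = fun y => p.[y] * y + c); last first.
  by apply/funext => y; rewrite hornerMXaddC.
apply: derivableD; last exact: derivable_cst.
by apply: derivableM; [exact: IH|exact: derivable_id].
Qed.

Lemma conj_realc (x : R) : (x%:C%C : C)^* = x%:C%C.
Proof. by apply/CrealP/complex_realP; exists x. Qed.

Lemma horner_near (p : {poly C}) (z : C) (e : R) : 0 < e ->
  exists2 d : R, 0 < d & forall y : C, `|z - y| < d%:C%C -> `|p.[z] - p.[y]| < e%:C%C.
Proof.
move=> e0; have e1 : 0 < e%:C%C :> C by rewrite ltcR.
have /cvgr_dist_lt/(_ _ e1)/nbhs_ballP[d /= d0 hd] := derivable_continuous (@derivable_horner p z).
exists (complex.Re d); first by rewrite -ltcR RRe_real // gtr0_real.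
by move=> y; rewrite RRe_real ?gtr0_real // => yz; exact: hd.
Qed.

(** After division by the gcd, the inequality extends by continuity to the whole disk. A zero of the
    reduced denominator in the disk would then be a zero of the reduced numerator, against
    coprimality; the quotient is therefore holomorphic. The roots of [N] are the points where the
    inequality is not known beforehand. *)
Lemma schur_of_ratio (p q N : {poly C}) : q != 0 -> N != 0 ->
    (forall a : C, `|a| < 1 -> N.[a] != 0 -> `|p.[a]| <= `|q.[a]|) ->
  exists2 s, schur_class R s & forall a : C, `|a| < 1 -> s a * q.[a] = p.[a].
Proof.
move=> q0 N0 pq; pose g := gcdp p q.
have g0 : g != 0 by rewrite gcdp_eq0 negb_and q0 orbT.
pose p' := p %/ g; pose q' := q %/ g.
have pE : p = p' * g by rewrite divpK ?dvdp_gcdl.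
have qE : q = q' * g by rewrite divpK ?dvdp_gcdr.
have cop : coprimep p' q' by rewrite coprimep_div_gcd // q0 orbT.
have le' a : `|a| < 1 -> `|p'.[a]| <= `|q'.[a]|.
  move=> a1; rewrite -subr_ge0; apply: ge0_closed => e e0.
  have e2 : 0 < e / 2 by lra.
  have [d1 d10 h1] := horner_near p' a e2; have [d2 d20 h2] := horner_near q' a e2.
  (* After the shift, a small positive nonroot [c] of [M] gives a point [c + a] close to [a] where
     neither [g] nor [N] vanishes. *)
  pose M := (g * N) \Po ('X + a%:P).
  have M0 : M != 0.
    by rewrite -size_poly_eq0 size_comp_poly2 ?size_XaddC // size_poly_eq0 mulf_neq0.
  have [ra ra0 aE] := norm_real a.
  have ra1 : ra < 1 by rewrite -ltcR -aE.
  pose d := Num.min (Num.min d1 d2) (1 - ra).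
  have dpos : 0 < d%:C%C :> C by rewrite ltcR !lt_min d10 d20 subr_gt0.
  have [c /andP[c0 cd] Mc] := exists_small_nonroot M0 dpos.
  have cac : `|a - (c + a)| = c by rewrite opprD addrCA subrr addr0 normrN gtr0_norm.
  have [cd1 cd2 cd3] : [/\ c < d1%:C%C, c < d2%:C%C & c < (1 - ra)%:C%C].
    by split; apply: lt_le_trans cd _; rewrite lecR !ge_min lexx ?orbT.
  have ca1 : `|c + a| < 1.
    apply: le_lt_trans (ler_normD _ _) _; rewrite aE gtr0_norm // -ltrBrDr.
    by rewrite -[1]/(1%:C%C) -rmorphB.
  move: Mc; rewrite horner_comp !hornerE mulf_eq0 negb_or => /andP[gc Nc].
  exists (`|q'.[c + a]| - `|p'.[c + a]|).
    have := pq _ ca1 Nc; rewrite {1}pE {1}qE !hornerM !normrM ler_pM2r ?normr_gt0 //.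
    by rewrite subr_ge0.
  have := h1 (c + a); have := h2 (c + a); rewrite cac => /(_ cd2) k2 /(_ cd1) k1.
  have -> : `|q'.[a]| - `|p'.[a]| - (`|q'.[c + a]| - `|p'.[c + a]|) =
     (`|q'.[a]| - `|q'.[c + a]|) - (`|p'.[a]| - `|p'.[c + a]|) by ring.
  apply: le_lt_trans (ler_normB _ _) _.
  apply: le_lt_trans (lerD (ler_dist_dist _ _) (ler_dist_dist _ _)) _.
  have -> : e%:C%C = (e / 2)%:C%C + (e / 2)%:C%C :> C by rewrite -rmorphD -splitr.
  exact: ltrD.
have q'N a : `|a| < 1 -> q'.[a] != 0.
  move=> a1; apply/negP => /eqP qa; have := le' a a1; rewrite qa normr0 normr_le0 => /eqP pa.
  by have := coprimep_root cop; move=> /(_ a); rewrite /root pa eqxx qa eqxx => /(_ isT).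
exists (fun z => p'.[z] / q'.[z]); last first.
  by move=> a a1; rewrite pE qE !hornerM mulrA divfK ?q'N.
split=> z z1.
  apply: derivableM; first exact: derivable_horner.
  by apply: derivableV; [exact: q'N|exact: derivable_horner].
by rewrite normrM normfV ler_pdivrMr ?mul1r ?le' // normr_gt0 q'N.
Qed.

(** Clears the poles at the nodes, so that the entries of the transfer function become ratios of
    polynomials in [b] with a common denominator. *)
Lemma horner_cauchy_num n (z : 'I_n -> C) (l : 'rV[C]_n) (b : C) :
    (forall j, z j != b) ->
  ((1 - 'X) * \sum_j (l 0 j)%:P * \prod_(k | k != j) ((z k)%:P - 'X)).[b] =
  (\prod_j ((z j)%:P - 'X)).[b] * ((1 - b) * (l *m cauchycol z b) 0 0).
Proof.
move=> zb; rewrite hornerM [RHS]mulrCA; congr (_ * _); first by rewrite !hornerE.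
rewrite mxE mulr_sumr horner_sum; apply: eq_bigr => j _.
rewrite hornerM hornerC mxE [in RHS](bigD1 j) //= hornerM.
rewrite [(_ - 'X).[b]](_ : _ = z j - b); last by rewrite !hornerE.
by field; rewrite subr_eq0.
Qed.

(* If no Blaschke factor lowers the number of negative squares, then
   [psi2 / (1 + psi1)] below is a Schur function, and its Pick kernel is, up to
   the factor [1 + psi1], the kernel displayed here. *)
Lemma resolvent_kernel_ge0 n (z w : 'I_n -> C) m (a u : 'I_m -> C) :
    (forall j, `|z j| < 1) -> pickmx z w \in unitmx ->
    (forall a, `|a| < 1 -> (forall j, z j != a) ->
       0 < 1 + (1 - `|a| ^+ 2) *
         ((cauchycol z a)^t* *m invmx (pickmx z w) *m cauchycol z a) 0 0) ->
    (forall i, `|a i| < 1) -> (forall i j, z j != a i) ->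
  0 <= \sum_i \sum_j u i * (u j)^* * (1 / (1 - a i * (a j)^* ) +
      ((cauchycol z (a j))^t* *m invmx (pickmx z w) *m cauchycol z (a i)) 0 0).
Proof.
move=> z1 uP pos a1 za; pose X := invmx (pickmx z w).
have hX : X^t* = X by rewrite /X trmx_inv map_invmx -pickmx_herm.
pose Pi := \prod_j ((z j)%:P - 'X : {poly C}).
have Pi0 : Pi != 0.
  apply/prodf_neq0 => j _; by rewrite -opprB oppr_eq0 polyXsubC_eq0.
have PiE b : (Pi.[b] != 0) -> forall j, z j != b.
  rewrite /Pi horner_prod => /prodf_neq0 h j; have := h j isT.
  by rewrite !hornerE subr_eq0.
pose psi (l : 'rV[C]_n) b := (1 - b) * (l *m cauchycol z b) 0 0.
pose l1 := (cauchycol z 1)^t* *m X.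
pose l2 := (\col_j (w j / (z j - 1)))^t* *m X.
have tr c d : (forall j, z j != c) -> (forall j, z j != d) ->
   (1 + psi l1 c)^* * (1 + psi l1 d) - (psi l2 c)^* * psi l2 d =
   1 + (1 - c^* * d) * ((cauchycol z c)^t* *m X *m cauchycol z d) 0 0.
  by move=> zc zd; exact: (transfer_identity z1 zc zd uP).
pose num (l : 'rV[C]_n) := (1 - 'X) * \sum_j (l 0 j)%:P * \prod_(k | k != j) ((z k)%:P - 'X).
pose p1 := Pi + num l1; pose p2 := num l2.
have p1E b : (forall j, z j != b) -> p1.[b] = Pi.[b] * (1 + psi l1 b).
  by move=> zb; rewrite hornerD horner_cauchy_num // mulrDr mulr1.
have p2E b : (forall j, z j != b) -> p2.[b] = Pi.[b] * psi l2 b.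
  by move=> zb; rewrite horner_cauchy_num.
(* The transfer identity on the diagonal: the difference of the squared moduli is the quantity
   assumed positive. *)
have lt21 b : `|b| < 1 -> (forall j, z j != b) -> `|psi l2 b| < `|1 + psi l1 b|.
  move=> b1 zb; rewrite -(@ltr_pXn2r _ 2) ?nnegrE // -subr_gt0 !normCK.
  by rewrite mulrC (mulrC (psi l2 b)) tr // (mulrC b^*) -normCK pos.
have [b0 /andP[b00 b01] Pb0] := exists_small_nonroot Pi0 ltr01.
have b1 : `|b0| < 1 by rewrite gtr0_norm.
have p10 : p1 != 0.
  have := lt21 _ b1 (PiE _ Pb0); apply: contraTneq => p10.
  have := p1E _ (PiE _ Pb0); rewrite p10 horner0 => /esym/eqP.
  by rewrite mulf_eq0 (negbTE Pb0) /= => /eqP ->; rewrite normr0 normr_lt0.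
have [b b1' Pb|s ss sE] := @schur_of_ratio p2 p1 Pi p10 Pi0.
  have zP := PiE _ Pb.
  rewrite (p1E _ zP) (p2E _ zP) (normrM _ (psi l2 b)) (normrM _ (1 + psi l1 b)).
  by apply: ler_wpM2l => //; exact: (ltW (lt21 _ b1' zP)).
have sE' b : `|b| < 1 -> Pi.[b] != 0 -> s b * (1 + psi l1 b) = psi l2 b.
  move=> b1' Pb; have := sE b b1'; rewrite p1E ?p2E; [|exact: PiE..].
  by rewrite mulrCA => /(mulfI Pb).
have Pa i : Pi.[a i] != 0.
  by rewrite horner_prod; apply/prodf_neq0 => j _; rewrite !hornerE subr_eq0.
have := schur_pick (\row_i (u i * (1 + psi l1 (a i)))) ss a1.
rewrite qformE; congr (0 <= _); apply: eq_bigr => i _; apply: eq_bigr => j _.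
have den := subr1_conjM_neq0 (a1 i) (ltW (a1 j)).
have E := tr (a j) (a i) (PiE _ (Pa j)) (PiE _ (Pa i)).
rewrite -(sE' _ (a1 i) (Pa i)) -(sE' _ (a1 j) (Pa j)) [(a j)^* * a i]mulrC in E.
rewrite [pickmx _ _ _ _]mxE ![(\row_ _ _) _ _]mxE.
rewrite !rmorphM /=.
transitivity (u i * (u j)^* * ((1 + psi l1 (a j))^* * (1 + psi l1 (a i)) -
   (s (a j) * (1 + psi l1 (a j)))^* * (s (a i) * (1 + psi l1 (a i)))) / (1 - a i * (a j)^* )).
  rewrite rmorphM /=; field; exact: den.
rewrite E; move: ((_ *m X *m _) 0 0) => K; field; exact: den.
Qed.

(** The kernel is evaluated at [a_i = z_i + r] with weights scaled by [r]. As [r] tends to 0, [r]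
    times the Cauchy column at [a_i] tends to minus the [i]-th basis vector and the scaled Szego
    term tends to 0, so the form of [P^-1] at [y] remains in the limit. *)
Lemma psd_of_positive_kernel n (z w : 'I_n -> C) x : injective z ->
    (forall j, `|z j| < 1) -> pickmx z w \in unitmx ->
    (forall a, `|a| < 1 -> (forall j, z j != a) ->
       0 < 1 + (1 - `|a| ^+ 2) *
         ((cauchycol z a)^t* *m invmx (pickmx z w) *m cauchycol z a) 0 0) ->
  0 <= qform (pickmx z w) x.
Proof.
move=> zI z1 uP pos; set P := pickmx z w; pose X := invmx P.
(* [P] is Hermitian, so [P = P X P^*] is congruent to [X]. *)
suff X0 y : 0 <= qform X y.
  have := X0 (x *m P); rewrite /qform mulmxK // trmx_mul map_mxM -pickmx_herm.
  by rewrite mulmxA.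
have [m /andP[m0 m1] zm] := max_norm_lt1 z1.
(* The entry of [e] times the Cauchy column at [z i + e], written so that it extends continuously to
   [e = 0]. *)
pose h (e : R) j i : C := if j == i then -1 else e%:C%C / (z j - z i - e%:C%C).
pose H e i : 'cV[C]_n := \col_j h e j i.
pose u i := (y 0 i)^*.
pose phi (e : R) := \sum_i \sum_j u i * (u j)^* *
  ((e ^+ 2)%:C%C / (1 - (z i + e%:C%C) * (z j + e%:C%C)^* ) + ((H e j)^t* *m X *m H e i) 0 0).
have phi0 : phi 0 = qform X y.
  have H0 i : H 0 i = - delta_mx i 0.
    apply/colP => j; rewrite !mxE /h eqxx andbT mul0r.
    by case: eqP; rewrite ?mulr1n ?oppr0.
  rewrite qformE exchange_big; apply: eq_bigr => i _; apply: eq_bigr => j _.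
  rewrite !H0 expr0n mul0r add0r /u conjCK [y 0 j * _]mulrC; congr (_ * _).
  have -> : (- delta_mx j 0 : 'cV[C]_n)^t* = - delta_mx 0 j.
    by apply/matrixP => k l; rewrite !mxE rmorphN andbC rmorph_nat.
  by rewrite mulNmx -rowE mulmxN mulNmx opprK -colE !mxE.
have cphi : cts phi 0.
  have cs (f : 'I_n -> R -> C) : (forall i, cts (f i) 0) -> cts (fun t => \sum_i f i t) 0.
    by move=> cf; apply: (@cts_on_sum R 0 0 n f) => [i t|]; rewrite ?lexx // => /le_anti <-.
  have ch i j : cts (fun t => h t i j) 0.
    rewrite /h; case: eqVneq => [_|ij]; first exact: cts_cst.
    have zij : z i - z j != 0 by rewrite subr_eq0 (inj_eq zI).
    apply: ctsM; first exact: cts_realC.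
    apply: ctsV; last by rewrite subr0.
    by apply: ctsB; [exact: cts_cst|exact: cts_realC].
  have ca i : cts (fun t : R => z i + t%:C%C) 0.
    by apply: ctsD; [exact: cts_cst|exact: cts_realC].
  apply: (cs) => i; apply: (cs) => j; apply: ctsM; first exact: cts_cst.
  apply: ctsD.
    apply: ctsM.
      rewrite (_ : (fun t : R => (t ^+ 2)%:C%C) = (fun t : R => t%:C%C * t%:C%C :> C)).
        by apply: ctsM; exact: cts_realC.
      by apply/funext => t; rewrite expr2 realcM.
    apply: ctsV; last by rewrite !addr0 subr1_conjM_neq0 // ltW.
    apply: ctsB; first exact: cts_cst.
    by apply: ctsM; [exact: ca|exact: (cts_conj (ca j))].
  rewrite (_ : (fun t : R => ((H t j)^t* *m X *m H t i) 0 0) =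
     (fun t : R => \sum_k (\sum_l (h t l j)^* * X l k) * h t k i)).
    apply: (cs) => k; apply: ctsM; last exact: ch.
    by apply: (cs) => l; apply: ctsM; [exact: (cts_conj (ch l j))|exact: cts_cst].
  apply/funext => t; rewrite mxE; apply: eq_bigr => k _.
  rewrite mxE [H t i k 0]mxE; congr (_ * _); apply: eq_bigr => l _.
  by rewrite !mxE.
rewrite -phi0; apply: ge0_closed => e e0.
have e1 : 0 < e%:C%C :> C by rewrite ltcR.
have /cvgr_dist_lt/(_ _ e1)/nbhs_ballP[dl /= dl0 hdl] := cphi.
(* Its roots are the differences of nodes, so at a nonroot [r] no point [z i + r] is a node. *)
pose M : {poly C} := \prod_i \prod_j ((z j - z i)%:P - 'X).
have M0 : M != 0.
  apply/prodf_neq0 => i _; apply/prodf_neq0 => j _.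
  by rewrite -opprB oppr_eq0 polyXsubC_eq0.
have d0 : 0 < (Num.min dl (1 - m))%:C%C :> C by rewrite ltcR lt_min dl0 subr_gt0.
have [c /andP[c0 cd] Mc] := exists_small_nonroot M0 d0.
have [r rE] : exists r : R, c = r%:C%C by exists (complex.Re c); rewrite RRe_real // gtr0_real.
rewrite {}rE in c0 cd Mc; rewrite ltcR in c0.
move: cd; rewrite ltcR lt_min => /andP[rdl rm].
exists (phi r); last first.
  by apply: hdl; rewrite /ball /= sub0r normrN ger0_norm // ltW.
pose a i := z i + r%:C%C.
have a1 i : `|a i| < 1.
  apply: le_lt_trans (ler_normD _ _) _; rewrite norm_real_complex (ger0_norm (ltW c0)).
  apply: (@lt_trans _ _ (m%:C%C + r%:C%C)); first by rewrite ltrD2r.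
  by rewrite -rmorphD ltcR; lra.
have r0 : r%:C%C != 0 :> C by rewrite -[0]/(0%:C%C) (inj_eq (@complexI _)) lt0r_neq0.
have za i j : z j != a i.
  move: Mc; rewrite horner_prod => /prodf_neq0/(_ i isT).
  rewrite horner_prod => /prodf_neq0/(_ j isT); rewrite !hornerE.
  by apply: contraNneq => ->; rewrite /a; apply/eqP; ring.
have HE i : H r i = r%:C%C *: cauchycol z (a i).
  apply/colP => j; rewrite !mxE /h /a; case: eqP => [->|_]; last by rewrite opprD addrA.
  by rewrite opprD addrA subrr sub0r invrN mulrN divff.
have := resolvent_kernel_ge0 (fun i => r%:C%C * u i) z1 uP pos a1 za.
congr (0 <= _); apply: eq_bigr => i _; apply: eq_bigr => j _.
rewrite !HE.
have -> : (r%:C%C *: cauchycol z (a j))^t* = r%:C%C *: (cauchycol z (a j))^t*.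
  apply/matrixP => k l; rewrite !mxE rmorphM; congr (_ * _).
  exact: conj_realc.
have mZ d (N : 'M[C]_1) : (d *: N) 0 0 = d * N 0 0 by rewrite mxE.
rewrite -!scalemxAl -!scalemxAr !mZ [(r%:C%C * u j)^*]rmorphM /= conj_realc expr2 realcM.
rewrite -/P -/X; move: ((_ *m X *m _) 0 0) => K; ring.
Qed.

End Rational.

(** * The Nevanlinna-Pick theorem *)

Section PsdNull.
Variable C : numClosedFieldType.

Lemma qform_delta n (A : 'M[C]_n) i : qform A (delta_mx 0 i) = A i i.
Proof.
rewrite qformE (bigD1 i) //= (bigD1 i) //= !big1 ?addr0.
- by rewrite !mxE !eqxx /= conjC1 !mul1r.
- by move=> j ji; rewrite big1 // => k _; rewrite !mxE (negbTE ji) andbF !mul0r.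
- by move=> j ji; rewrite !mxE (negbTE ji) andbF conjC0 mulr0 mul0r.
Qed.

(** With a zero diagonal entry the form is affine in the real and imaginary parts of the [i]-th
    coordinate, so a nonzero [A i j] would make it unbounded below. *)
Lemma psd_diag0 n (A : 'M[C]_n) i j : A = A^t* -> (forall x, 0 <= qform A x) ->
  A i i = 0 -> A i j = 0.
Proof.
move=> hA A0 Aii; have [<- //|ij] := eqVneq i j.
have ji : j != i by rewrite eq_sym.
have hA' k l : (A k l)^* = A l k by rewrite {2}hA !mxE.
have q t : qform A (t *: delta_mx 0 i + delta_mx 0 j) = t * A i j + t^* * A j i + A j j.
  rewrite qformE (bigD1 i) //= [X in _ + X](bigD1 j) //= [X in _ + (_ + X)]big1 ?addr0; last first.
    move=> k /andP[ki kj]; rewrite big1 // => l _.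
    by rewrite !mxE (negbTE ki) (negbTE kj) !andbF mulr0 addr0 !mul0r.
  have row2 k (u : C) : \sum_l u * ((t *: delta_mx 0 i + delta_mx 0 j : 'rV[C]_n) 0 l)^* * A k l =
     u * t^* * A k i + u * A k j.
    rewrite (bigD1 i) //= [X in _ + X](bigD1 j) //= [X in _ + (_ + X)]big1 ?addr0; last first.
      move=> l /andP[li lj]; rewrite !mxE (negbTE li) (negbTE lj) !andbF mulr0 addr0.
      by rewrite conjC0 mulr0 mul0r.
    by rewrite !mxE !eqxx (negbTE ij) (negbTE ji) /= mulr1 mulr0 addr0 add0r conjC1 mulr1.
  rewrite !row2 !mxE !eqxx (negbTE ij) (negbTE ji) /= Aii mulr1 mulr0 addr0 add0r; ring.
apply/eqP; apply: contraT => Aij.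
have N0 : 0 < A i j * A j i by rewrite -(hA' i j) -normCK exprn_gt0 // normr_gt0.
have Ajj : 0 <= A j j by rewrite -qform_delta.
(* Chosen so that the form takes the negative value [- (A j j + 2)]. *)
pose la := (A j j + 1) / (A i j * A j i).
have la0 : 0 < la by rewrite divr_gt0 // ltr_wpDl.
have := A0 (- (la * A j i) *: delta_mx 0 i + delta_mx 0 j).
rewrite q rmorphN rmorphM /= hA' (geC0_conj (ltW la0)).
have -> : - (la * A j i) * A i j + - (la * A i j) * A j i + A j j = - (A j j + 1 + 1).
  have := lt0r_neq0 N0; rewrite mulf_eq0 negb_or => /andP[n1 n2].
  by rewrite /la; field; rewrite n1 n2.
by rewrite oppr_ge0 lt_geF // addr_gt0 // ltr_wpDl.
Qed.

End PsdNull.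

Section NevanlinnaPick.
Variable R : realType.
Local Notation C := R[i].

Lemma norm_bfactor_le (a z : C) : `|a| < 1 -> `|z| < 1 -> `|bfactor a z| <= 1.
Proof.
move=> a1 z1; have den := subr1_conjM_neq0 z1 (ltW a1).
rewrite normrM normfV ler_pdivrMr ?normr_gt0 // mul1r -(@ler_pXn2r _ 2) ?nnegrE //.
rewrite -subr_ge0 !normCK.
have -> : (1 - z * a^* ) * (1 - z * a^* )^* - (z - a) * (z - a)^* =
    (1 - `|z| ^+ 2) * (1 - `|a| ^+ 2).
  by rewrite !normCK !(rmorphB, rmorphM, rmorph1) /= conjCK; ring.
by rewrite mulr_ge0 // subr_ge0 exprn_ile1 // ltW.
Qed.

Lemma derivable_bfactor (a z : C) : `|a| < 1 -> `|z| < 1 ->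
  derivable (bfactor a : C^o -> C^o) z 1.
Proof.
move=> a1 z1; apply: derivableM.
  by apply: derivableB; [exact: derivable_id|exact: derivable_cst].
apply: derivableV; first by rewrite subr1_conjM_neq0 // ltW.
apply: derivableB; first exact: derivable_cst.
by apply: derivableM; [exact: derivable_id|exact: derivable_cst].
Qed.

Lemma schur_bfactor (a : C) : `|a| < 1 -> schur_class R (bfactor a).
Proof.
by move=> a1; split=> z z1; [exact: derivable_bfactor|exact: norm_bfactor_le].
Qed.

Lemma schur_cst (c : C) : `|c| <= 1 -> schur_class R (fun=> c).
Proof. by move=> c1; split=> z z1; [exact: derivable_cst|]. Qed.

Lemma schurM (f g : C -> C) : schur_class R f -> schur_class R g ->
  schur_class R (fun z => f z * g z).
Proof.
move=> [hf f1] [hg g1]; split=> z z1.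
  by apply: derivableM; [exact: hf|exact: hg].
by rewrite normrM mulr_ile1 // ?f1 ?g1.
Qed.

Lemma schur_mobius (s : C) (h : C -> C) : `|s| < 1 -> schur_class R h ->
  schur_class R (fun z => (s + h z) / (1 + s^* * h z)).
Proof.
move=> s1 [hh h1].
have den z : `|z| < 1 -> 1 + s^* * h z != 0.
  move=> z1; have := subr1_conjM_neq0 (_ : `|- s^*| < 1) (_ : `|(h z)^*| <= 1).
  by rewrite conjCK mulNr opprK; apply; rewrite ?normrN norm_conjC // h1.
split=> z z1.
  apply: derivableM.
    by apply: derivableD; [exact: derivable_cst|exact: hh].
  apply: derivableV; first exact: den.
  apply: derivableD; first exact: derivable_cst.
  by apply: derivableM; [exact: derivable_cst|exact: hh].
rewrite normrM normfV ler_pdivrMr ?normr_gt0 ?den // mul1r -(@ler_pXn2r _ 2) ?nnegrE //.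
rewrite -subr_ge0 !normCK.
have -> : (1 + s^* * h z) * (1 + s^* * h z)^* - (s + h z) * (s + h z)^* =
    (1 - `|s| ^+ 2) * (1 - `|h z| ^+ 2).
  by rewrite !normCK !(rmorphD, rmorphM, rmorph1) /= conjCK; ring.
by rewrite mulr_ge0 // subr_ge0 exprn_ile1 // ?h1 // ltW.
Qed.

Theorem nevanlinna_pick n (z w : 'I_n -> C) : injective z -> (forall j, `|z j| < 1) ->
    (forall x, 0 <= qform (pickmx z w) x) ->
  exists2 f, schur_class R f & forall j, f (z j) = w j.
Proof.
elim: n z w => [|n IHn] z w zI z1 P0.
  by exists (fun=> 0); [apply: schur_cst; rewrite normr0|case].
have w1 j : `|w j| <= 1.
  have := P0 (delta_mx 0 j); rewrite qform_delta mxE -!normCK.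
  by rewrite pmulr_lge0 ?invr_gt0 ?subr_gt0 ?exprn_ilt1 // subr_ge0 expr_le1.
have zN j : z (lift 0 j) != z 0 by rewrite (inj_eq zI) eq_sym neq_lift.
(* If [|w 0| = 1], the diagonal entry at node 0 vanishes, hence its whole row, which forces every
   [w j] to equal [w 0]: a constant interpolates. *)
have [w01|w0N] := eqVneq `|w 0| 1.
  exists (fun=> w 0); first by apply: schur_cst; rewrite w01.
  move=> j; have := @psd_diag0 _ _ _ 0 j (pickmx_herm z w) P0.
  rewrite mxE -normCK w01 expr1n subrr mul0r mxE => /(_ erefl)/eqP.
  have den := subr1_conjM_neq0 (z1 0) (ltW (z1 j)).
  rewrite mulf_eq0 invr_eq0 (negbTE den) orbF subr_eq0.
  move=> /eqP E; have := congr1 (fun c => c^* * w 0) E.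
  rewrite conjC1 mul1r rmorphM /= conjCK [(w 0)^* * _]mulrC -mulrA [(w 0)^* * _]mulrC -normCK.
  by rewrite w01 expr1n mulr1.
have w0lt : `|w 0| < 1 by rewrite lt_neqAle w0N w1.
have wN j : 1 - (w 0)^* * w (lift 0 j) != 0.
  have := subr1_conjM_neq0 (_ : `|(w 0)^*| < 1) (_ : `|(w (lift 0 j))^*| <= 1).
  by rewrite conjCK; apply; rewrite norm_conjC.
have bN j : bfactor (z 0) (z (lift 0 j)) != 0 by apply: bfactor_neq0.
have P00 := pickmx00_gt0 (z1 0) w0lt.
pose w' j := (w (lift 0 j) - w 0) / (1 - (w 0)^* * w (lift 0 j)) / bfactor (z 0) (z (lift 0 j)).
pose D j := bfactor (z 0) (z (lift 0 j)) * (1 - (w 0)^* * w (lift 0 j)).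
have DN j : D j != 0 by rewrite mulf_neq0.
have P'0 y : 0 <= qform (pickmx (fun j => z (lift 0 j)) w') y.
  (* The value of the coordinate at node 0 that makes the pivot square vanish, leaving only the
     reduced form. *)
  pose t := - (\sum_j y 0 j / D j * pickmx z w (lift 0 j) 0) / pickmx z w 0 0.
  pose x : 'rV[C]_n.+1 := \row_i if unlift 0 i is Some j then y 0 j / D j else t.
  have x0 : x 0 0 = t by rewrite mxE unlift_none.
  have xl j : x 0 (lift 0 j) = y 0 j / D j by rewrite mxE liftK.
  have := P0 x; rewrite (pickmx_schur x z1 zN w0N wN) big_ord_recl x0.
  under eq_bigr do rewrite xl.
  rewrite {1}/t divfK ?lt0r_neq0 // addNr normr0 expr0n mul0r add0r.
  have -> : \row_j (x 0 (lift 0 j) * D j) = y.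
    by apply/rowP => j; rewrite mxE xl divfK.
  by rewrite pmulr_lge0 // invr_gt0 subr_gt0 exprn_ilt1.
have [i j /zI/lift_inj // | // |f' sf' f'E] := IHn (fun j => z (lift 0 j)) w' _ _ P'0.
(* The Schur step undone: multiplication by the Blaschke factor at [z 0], then the disk automorphism
   taking 0 to [w 0]. *)
exists (fun u => (w 0 + bfactor (z 0) u * f' u) / (1 + (w 0)^* * (bfactor (z 0) u * f' u))).
  exact: (schur_mobius w0lt (schurM (schur_bfactor (z1 0)) sf')).
move=> i; case: (unliftP 0 i) => [j ->|->]; last first.
  by rewrite /bfactor subrr !mul0r mulr0 !addr0 divr1.
have -> : bfactor (z 0) (z (lift 0 j)) * f' (z (lift 0 j)) =
    (w (lift 0 j) - w 0) / (1 - (w 0)^* * w (lift 0 j)).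
  by rewrite f'E /w' mulrC divfK.
have w02 : 1 - w 0 * (w 0)^* != 0 by rewrite subr1_conjM_neq0.
have den : 1 + (w 0)^* * ((w (lift 0 j) - w 0) / (1 - (w 0)^* * w (lift 0 j))) =
   (1 - w 0 * (w 0)^* ) / (1 - (w 0)^* * w (lift 0 j)) by field.
rewrite den; have := wN j; move: w02 => ? ?; field.
by apply/andP; split.
Qed.

End NevanlinnaPick.

(** * Negative squares traded for Blaschke factors *)

Section Iteration.
Variable R : realType.
Local Notation C := R[i].

Lemma nonneg_codim0 n (A : 'M[C]_n) x : nonneg_codim A 0 -> 0 <= qform A x.
Proof.
move=> [m [U [rU U0]]]; apply/U0/submx_full; rewrite /row_full eqn_leq rank_leq_col.
by rewrite addn0 in rU.
Qed.

(** The perturbation is repeated at every stage because the Pick matrix may be singular again after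
    a reduction. The scalings commute with the Blaschke factors and multiply into one [t]; half of
    the tolerance is spent on the current stage and half on the remaining ones. *)
Lemma exists_blaschke_psd n (z w : 'I_n -> C) k (d : R) : injective z ->
    (forall j, `|z j| < 1) -> nonneg_codim (pickmx z w) k -> 0 < d ->
  exists (t : C) (a : 'I_k -> C), [/\ 0 < t <= 1, 1 - d%:C%C < t, forall i, `|a i| < 1 &
    forall x, 0 <= qform (pickmx z (fun j => \prod_i bfactor (a i) (z j) * (t * w j))) x].
Proof.
move=> zI z1; elim: k w d => [|k IHk] w d hk d0.
  exists 1, (fun=> 0); split; [by rewrite ltr01 lexx| |by case|].
    by rewrite -subr_gt0 opprB addrCA subrr addr0 ltcR.
  move=> x; have <- : pickmx z w = pickmx z (fun j => \prod_(i < 0) bfactor 0 (z j) * (1 * w j)).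
    by apply/matrixP => i j; rewrite !mxE !big_ord0 !mul1r.
  exact: nonneg_codim0.
have d2 : 0 < (d / 2)%:C%C :> C by rewrite ltcR divr_gt0.
have [t [tpos /andP[t0 t1] uP hP]] := pickmx_perturb w zI z1 d2.
pose w1 j := t * w j; pose P := pickmx z w1.
have [a a1 ak] : exists2 a, `|a| < 1 & nonneg_codim (pickmx z (fun j => bfactor a (z j) * w1 j)) k.
  have [[a [a1 za neg]]|no] := pselect (exists a, [/\ `|a| < 1, forall j, z j != a &
    1 + (1 - `|a| ^+ 2) * ((cauchycol z a)^t* *m invmx P *m cauchycol z a) 0 0 <= 0]).
    by exists a; [exact: a1|exact: (pickmx_reduce z1 a1 za uP (hP _ hk) neg)].
  (* No admissible [a] lowers the count, so the Pick matrix is already positive. A zero at 0 is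
     added to keep the degree; it only adds a positive rank one matrix to a congruent one. *)
  exists 0; first by rewrite normr0.
  apply: nonneg_codim_psd => x; rewrite qform_pickmx_bfactor ?normr0 // expr0n subr0 mul1r.
  rewrite addr_ge0 ?exprn_ge0 //; apply: psd_of_positive_kernel => // a a1 za.
  have hX : invmx P = (invmx P)^t* by rewrite trmx_inv map_invmx -pickmx_herm.
  have kR : ((cauchycol z a)^t* *m invmx P *m cauchycol z a) 0 0 \is Num.real.
    by have := qform_real ((cauchycol z a)^t* ) hX; rewrite /qform trmxCK.
  rewrite real_ltNge ?real0 ?rpredD ?rpred1 ?rpredM ?rpredB ?rpredX ?normr_real ?rpred1 //.
  by apply/negP => neg; apply: no; exists a.
have d2' : 0 < d / 2 by rewrite divr_gt0.
have [t' [a' [/andP[tpos' t1'] t0' a1' psd]]] := IHk _ _ ak d2'.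
exists (t' * t), (fun i => if unlift 0 i is Some j then a' j else a); split.
- by rewrite mulr_gt0 // mulr_ile1 // ltW.
- rewrite -subr_gt0.
  have -> : t' * t - (1 - d%:C%C) =
      (1 - t') * (1 - t) + (t' - (1 - (d / 2)%:C%C)) + (t - (1 - (d / 2)%:C%C)).
    by rewrite [in LHS](splitr d) rmorphD /=; ring.
  by rewrite addr_gt0 ?subr_gt0 // ltr_wpDl ?subr_gt0 // mulr_ge0 ?subr_ge0.
- by move=> i; case: (unliftP 0 i).
move=> x; have := psd x.
have -> // : (fun j => \prod_i bfactor (a' i) (z j) * (t' * (bfactor a (z j) * w1 j))) =
  (fun l => \prod_(i < k.+1) bfactor (if unlift 0 i is Some j then a' j else a) (z l) *
     (t' * t * w l)).
apply/funext => l; rewrite big_ord_recl unlift_none; under [in RHS]eq_bigr do rewrite liftK.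
by rewrite /w1; ring.
Qed.

End Iteration.

(** * Compactness of Blaschke products along an ultrafilter *)

Section Limits.
Variable R : realType.
Local Notation C := R[i].

Lemma cvg_conj (T : Type) (F : set_system T) {FF : Filter F} (f : T -> C) (l : C) :
  (f : T -> C^o) @ F --> (l : C^o) -> ((fun x => (f x)^* ) : T -> C^o) @ F --> (l^* : C^o).
Proof.
move=> fl; apply/(@cvgrPdist_lt C C^o) => e e0.
have H := (@cvgrPdist_lt C C^o _ _ _ _ _).1 fl e e0.
near=> x; rewrite -rmorphB norm_conjC; near: x; exact: H.
Unshelve. all: by end_near.
Qed.

(** Compactness of the segment yields a cluster point, and an ultrafilter converges to each of its
    cluster points. *)
Lemma ultra_cvg_real (F : set_system nat) (x : nat -> R) : UltraFilter F ->
  (forall m, -1 <= x m <= 1) -> exists l : R, x @ F --> l.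
Proof.
move=> FU x1.
have xF : F (x @^-1` [set` `[(-1 : R), 1]]).
  by apply: (@filterE _ F) => m; rewrite /= in_itv /=; exact: x1.
have [l [_ xl]] := @segment_compact R (-1) 1 (x @ F) _ xF.
exists l => V Vl; have [//|FnV] := in_ultra_setVsetC (x @^-1` V) FU.
by have [y []] := xl (~` V) V FnV Vl.
Qed.

Lemma ultra_cvg (F : set_system nat) (x : nat -> C) : UltraFilter F ->
  (forall m, `|x m| <= 1) -> exists l : C, (x : nat -> C^o) @ F --> (l : C^o).
Proof.
move=> FU x1.
have [u hu] : exists u : R, (fun m => complex.Re (x m)) @ F --> u.
  apply: ultra_cvg_real => m; rewrite -ler_norml -lecR.
  exact: le_trans (normc_ge_Re _) (x1 m).
have [v hv] : exists v : R, (fun m => complex.Im (x m)) @ F --> v.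
  apply: ultra_cvg_real => m; rewrite -ler_norml -lecR.
  exact: le_trans (normc_ge_Im _) (x1 m).
exists (u +i* v)%C; apply/(@cvgrPdist_lt C C^o) => e e0.
have [e1 eE] : exists e1 : R, e = e1%:C%C.
  by exists (complex.Re e); rewrite RRe_real // gtr0_real.
rewrite eE ltcR in e0 *; have e2 : 0 < e1 / 2 by rewrite divr_gt0.
have hf := (@cvgrPdist_lt R R^o _ _ _ _ _).1 hu _ e2.
have hg := (@cvgrPdist_lt R R^o _ _ _ _ _).1 hv _ e2.
near=> t; apply: le_lt_trans (normc_le_ReIm _) _.
rewrite ltcR [e1]splitr !raddfB /= ltrD //; near: t; [exact: hf|exact: hg].
Unshelve. all: by end_near.
Qed.

Lemma cvg_sum_ord (F : set_system nat) {FF : Filter F} n (f : 'I_n -> nat -> C) (l : 'I_n -> C) :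
  (forall i, (f i : nat -> C^o) @ F --> (l i : C^o)) ->
  ((fun m => \sum_i f i m) : nat -> C^o) @ F --> (\sum_i l i : C^o).
Proof.
elim: n f l => [|n IHn] f l fl.
  by rewrite big_ord0; under eq_fun do rewrite big_ord0; apply: cvg_cst.
rewrite big_ord_recl; under eq_fun do rewrite big_ord_recl.
by apply: cvgD; [exact: fl|apply: IHn => i; exact: fl].
Qed.

Lemma cvg_prod_ord (F : set_system nat) {FF : Filter F} n (f : 'I_n -> nat -> C) (l : 'I_n -> C) :
  (forall i, (f i : nat -> C^o) @ F --> (l i : C^o)) ->
  ((fun m => \prod_i f i m) : nat -> C^o) @ F --> (\prod_i l i : C^o).
Proof.
elim: n f l => [|n IHn] f l fl.
  by rewrite big_ord0; under eq_fun do rewrite big_ord0; apply: cvg_cst.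
rewrite big_ord_recl; under eq_fun do rewrite big_ord_recl.
by apply: cvgM; [exact: fl|apply: IHn => i; exact: fl].
Qed.

(** An ultrafilter finer than [\oo] makes all [k] sequences of zeros converge together, without
    successive extraction of subsequences. The nodes lie in the open disk, so a Blaschke factor at a
    node depends continuously on its zero up to the unit circle, and positivity passes to the
    limit. *)
Lemma exists_closed_blaschke_psd n (z w : 'I_n -> C) k : injective z ->
    (forall j, `|z j| < 1) -> nonneg_codim (pickmx z w) k ->
  exists al : 'I_k -> C, (forall i, `|al i| <= 1) /\
    forall x, 0 <= qform (pickmx z (fun j => \prod_i bfactor (al i) (z j) * w j)) x.
Proof.
move=> zI z1 hk.
have /choice[ta hta] : forall m : nat, exists ta : C * ('I_k -> C),
  [/\ 0 < ta.1 <= 1, 1 - (m.+1%:R^-1)%:C%C < ta.1, forall i, `|ta.2 i| < 1 &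
    forall x, 0 <= qform (pickmx z (fun j => \prod_i bfactor (ta.2 i) (z j) * (ta.1 * w j))) x].
  move=> m; have m0 : 0 < m.+1%:R^-1 :> R by rewrite invr_gt0.
  by have [t [a h]] := exists_blaschke_psd zI z1 hk m0; exists (t, a).
have [U [UU ooU]] := @ultraFilterLemma nat \oo _.
have /choice[al hal] : forall i, exists l : C,
    ((fun m => (ta m).2 i) : nat -> C^o) @ U --> (l : C^o).
  by move=> i; apply: ultra_cvg => m; have [_ _ /(_ i)/ltW] := hta m.
have ht : ((fun m => (ta m).1) : nat -> C^o) @ U --> (1 : C^o).
  apply/(@cvgrPdist_lt C C^o) => e e0; apply: ooU.
  have [e1 eE] : exists e1 : R, e = e1%:C%C.
    by exists (complex.Re e); rewrite RRe_real // gtr0_real.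
  rewrite eE ltcR in e0 *.
  have := near_infty_natSinv_lt (PosNum e0); apply: filterS => m /= me.
  have [/andP[t0 t1] t2 _ _] := hta m.
  rewrite ger0_norm ?subr_ge0 //; apply: lt_trans (_ : (m.+1%:R^-1)%:C%C < _).
    by rewrite ltrBlDr addrC -ltrBlDr.
  by rewrite ltcR.
have al1 i : `|al i| <= 1.
  rewrite -subr_ge0; apply: ge0_closed => e e0.
  have e1 : 0 < e%:C%C :> C by rewrite ltcR.
  have /cvgrPdist_lt/(_ _ e1)/filter_ex[m hm] := hal i.
  exists (1 - `|(ta m).2 i|); first by have [_ _ /(_ i) ?] := hta m; rewrite subr_ge0 ltW.
  apply: le_lt_trans hm.
  have -> : 1 - `|al i| - (1 - `|(ta m).2 i|) = - (`|al i| - `|(ta m).2 i|) by ring.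
  by rewrite normrN ler_dist_dist.
exists al; split=> // x.
pose v m j := \prod_i bfactor ((ta m).2 i) (z j) * ((ta m).1 * w j).
pose v0 j := \prod_i bfactor (al i) (z j) * w j.
have hv j : ((fun m => v m j) : nat -> C^o) @ U --> (v0 j : C^o).
  rewrite /v0 -[w j]mul1r; apply: cvgM; last by apply: cvgM; [exact: ht|exact: cvg_cst].
  apply: cvg_prod_ord => i; apply: cvgM.
    by apply: cvgB; [exact: cvg_cst|exact: hal].
  apply: cvgV; first by rewrite subr1_conjM_neq0.
  apply: cvgB; first exact: cvg_cst.
  by apply: cvgM; [exact: cvg_cst|apply: cvg_conj; exact: hal].
have hq : ((fun m => qform (pickmx z (v m)) x) : nat -> C^o) @ U --> (qform (pickmx z v0) x : C^o).
  rewrite qformE; under eq_fun do rewrite qformE.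
  apply: cvg_sum_ord => i; apply: cvg_sum_ord => j.
  rewrite mxE; under eq_fun do rewrite mxE.
  apply: cvgM; first exact: cvg_cst.
  apply: cvgM; last exact: cvg_cst.
  apply: cvgB; first exact: cvg_cst.
  by apply: cvgM; [exact: hv|apply: cvg_conj; exact: hv].
apply: ge0_closed => e e0.
have e1 : 0 < e%:C%C :> C by rewrite ltcR.
have /cvgrPdist_lt/(_ _ e1)/filter_ex[m hm] := hq.
by exists (qform (pickmx z (v m)) x) => //; have [_ _ _] := hta m; apply.
Qed.

End Limits.

(** * Back to eigenvalues and to Blaschke products of exact degree *)

Section Main.
Variable R : realType.
Local Notation C := R[i].

Lemma nonneg_codim_num_neg n (A : 'M[C]_n) k : A = A^t* ->
  nonneg_codim A k <-> (num_neg_eigenvalues A <= k)%N.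
Proof.
move=> hA; apply: hermitian_count => //; rewrite /eigenvalues.
case: closed_field_poly_normal => s /= {1}->.
by rewrite (monicP (char_poly_monic A)) scale1r.
Qed.

Lemma bfactor_unimodular (a z : C) : `|a| = 1 -> `|z| < 1 -> bfactor a z = - a.
Proof.
move=> a1 z1; have den : 1 - z * a^* != 0 by rewrite subr1_conjM_neq0 ?a1.
apply: (mulIf den); rewrite divfK // mulrBr mulr1 mulNr mulrCA -normCK a1 expr1n mulr1.
by rewrite opprK addrC.
Qed.

Lemma schur_prod k (h : 'I_k -> C -> C) : (forall i, schur_class R (h i)) ->
  schur_class R (fun z => \prod_i h i z).
Proof.
elim: k h => [|k IHk] h hs.
  under eq_fun do rewrite big_ord0.
  by apply: schur_cst; rewrite normr1.
under eq_fun do rewrite big_ord_recl.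
by apply: schurM; [exact: hs|apply: IHk => i; exact: hs].
Qed.

(** A limit zero on the unit circle contributes only a unimodular constant and would lower the
    degree. Its constant goes into [g], its zero is replaced by one at the origin, and the extra
    factor [u] this brings into [B] is matched by the same factor in [f]. *)
Lemma interpolation_of_nonneg_codim n (z w : 'I_n -> C) k : injective z ->
    (forall j, `|z j| < 1) -> nonneg_codim (pickmx z w) k ->
  exists f B : C -> C, [/\ schur_class R f, blaschke_product k B &
    forall j, f (z j) = B (z j) * w j].
Proof.
move=> zI z1 /(exists_closed_blaschke_psd zI z1)[al [al1 psd]].
have [f sf fE] := nevanlinna_pick zI z1 psd.
pose a i := if `|al i| == 1 then 0 else al i.
pose g := \prod_i (if `|al i| == 1 then - al i else 1).
pose h i (u : C) := if `|al i| == 1 then u else 1.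
exists (fun u => f u * \prod_i h i u), (fun u => g * \prod_i bfactor (a i) u); split.
- apply: schurM => //; apply: schur_prod => i; rewrite /h; case: (`|al i| == 1).
    by split=> u u1; [exact: derivable_id|exact: ltW].
  by apply: schur_cst; rewrite normr1.
- exists g, a; split=> //.
    rewrite normr_prod big1 // => i _; case: ifP => [/eqP|_]; rewrite ?normr1 ?normrN //.
  move=> i; rewrite /a /unit_disk /=; case: ifP => [_|/negbT al1N]; first by rewrite normr0.
  by rewrite lt_neqAle al1N al1.
move=> j; rewrite fE mulrAC; congr (_ * _).
rewrite /g -!big_split; apply: eq_bigr => i _; rewrite /h /a /=.
case: ifP => [/eqP al1E|_]; last by rewrite mulr1 mul1r.
by rewrite (bfactor_unimodular al1E) // /bfactor subr0 conjC0 mulr0 subr0 divr1.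
Qed.

End Main.

Theorem theorem3p1 (R : realType) (n : nat) (z w : 'I_n -> R[i]) (kappa : nat)
    (hz : injective z) (hzD : forall j, unit_disk R (z j)) :
  (num_neg_eigenvalues (pick_matrix z w) = kappa ->
     exists f B : R[i] -> R[i],
       [/\ schur_class R f, blaschke_product kappa B &
           forall j, f (z j) = B (z j) * w j]) /\
  ((exists f B : R[i] -> R[i],
       [/\ schur_class R f, blaschke_product kappa B &
           forall j, f (z j) = B (z j) * w j]) ->
     (num_neg_eigenvalues (pick_matrix z w) <= kappa)%N).
Proof.
have -> : pick_matrix z w = pickmx z w by apply/matrixP => i j; rewrite !mxE.
have z1 j : `|z j| < 1 := hzD j.
split=> [nk|[f [B [sf [g [a [g1 a1 BE]]] fE]]]].
  apply: (interpolation_of_nonneg_codim hz z1).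
  by apply/(nonneg_codim_num_neg _ (pickmx_herm z w)); rewrite nk.
apply/(nonneg_codim_num_neg _ (pickmx_herm z w)).
apply: (@nonneg_codim_of_interpolation _ _ _ z w (f \o z) (B \o z)) => //=.
  by move=> x; apply: schur_pick.
have [V VP] := blaschke_kernel z1 (fun i => ltW (a1 i)) g1.
have BzE : B \o z = fun j => g * \prod_(i < kappa) bfactor (a i) (z j).
  by apply/funext => j; rewrite /= BE //; exact: hzD.
by exists V => x; rewrite BzE; exact: VP.
Qed.
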